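(* Let $G$ be an undirected graph on the vertex set $\{0,1,\dots,n\}$ with $|G|$ edges, let $\mathbb{K}$ be a field, and fix a linear ordering of the edges of $G$. Then for every $k\ge 0$, $$\dim\mathcal{A}_G^k=\dim\mathcal{B}_G^k=N_G^{|G|-n-k},$$ the number of spanning trees of $G$ of external activity $|G|-n-k$.
   Context: The graph $G$ may have multiple edges and loops; $a_{ij}=a_{ji}$ is the number of edges joining $i$ and $j$. For $I\subseteq\{1,\dots,n\}$ and $i\in I$, $d_I(i)=\sum_{j\in\{0,\dots,n\}\setminus I}a_{ij}$ and $D_I=\sum_{i\in I}d_I(i)$. Let $\mathcal{I}_G\subset\mathbb{K}[x_1,\dots,x_n]$ be generated by $m_I=\prod_{i\in I}x_i^{d_I(i)}$ and $\mathcal{J}_G$ by $p_I=(\sum_{i\in I}x_i)^{D_I}$, over all nonempty $I\subseteq\{1,\dots,n\}$; $\mathcal{A}_G=\mathbb{K}[x_1,\dots,x_n]/\mathcal{I}_G$, $\mathcal{B}_G=\mathbb{K}[x_1,\dots,x_n]/\mathcal{J}_G$, and $\mathcal{A}_G^k,\mathcal{B}_G^k$ denote their degree-$k$ graded components. For a spanning tree $T$ of $G$, an edge $e\in G\setminus T$ is externally active if there is a cycle $C$ in $G$ such that $e$ is the minimal edge of $C$ and $C\setminus\{e\}\subset T$; the external activity of $T$ is the number of its externally active edges. $N_G^m$ denotes the number of spanning trees of external activity $m$.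
   Formalization: The equality for B_G is stated only for K of characteristic 0, since it fails otherwise (triangle in characteristic 2: x1x2 is nonzero in B_G^2 but the tree count is 0); the equality for A_G is stated over every field. *)

(* Defs.v *)
From HB Require Import structures.
From mathcomp Require Import all_boot all_order all_algebra.
From mathcomp.multinomials Require Import mpoly.

Set Implicit Arguments.
Unset Strict Implicit.
Unset Printing Implicit Defensive.

Import GRing.Theory.
Local Open Scope ring_scope.

(** * Multigraphs on {0, ..., n} *)

(* An edge carries its unordered set of endpoints; a singleton is a loop, and *)
(* distinct edges may have the same endpoints.                                *)
Record multigraph (n : nat) := Multigraph {
  edge : finType;
  ends : edge -> {set 'I_n.+1};
  ends_card : forall e, (0 < #|ends e| <= 2)%N
}.

Section Graph.
Variables (n : nat) (G : multigraph n).
Implicit Types (i j u v : 'I_n.+1) (e f : edge G) (T C : {set edge G}).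

Definition joins e i j : bool := ends e == [set i; j].

Definition nb_edges i j : nat := #|[set e | joins e i j]|.

(* C = {e_0, ..., e_(k-1)} with k = #|C| > 0, and e_i joins v_i and v_(i+1),  *)
(* indices mod k, where the v_i are distinct. For k = 1 this is a loop, for   *)
(* k = 2 a pair of parallel edges.                                            *)
Definition graph_cycle C : bool :=
  (0 < #|C|)%N &&
  [exists v : {ffun 'I_#|C| -> 'I_n.+1}, exists e : {ffun 'I_#|C| -> edge G},
    [&& injectiveb v, e @: setT == C &
        [forall i, joins (e i) (v i) (v (ordS i))]]].

Definition adjacent_in T : rel 'I_n.+1 :=
  [rel u v | [exists e in T, joins e u v]].

Definition spanning_tree T : bool :=
  [forall u, forall v, connect (adjacent_in T) u v] &&
  ~~ [exists C : {set edge G}, graph_cycle C && (C \subset T)].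

Section Activity.
Variable le : rel (edge G).

Definition externally_active T e : bool :=
  (e \notin T) &&
  [exists C : {set edge G},
    [&& graph_cycle C, e \in C, [forall f in C, le e f] & C :\ e \subset T]].

Definition external_activity T : nat := #|[set e | externally_active T e]|.

(* m ranges over int, so that the count is 0 for m < 0. *)
Definition nb_trees (m : int) : nat :=
  #|[set T | spanning_tree T & (external_activity T)%:Z == m]|.

End Activity.

(* The variable x_(i+1) is 'X_i for i : 'I_n; it belongs to the vertex i + 1. *)
Definition vertex (i : 'I_n) : 'I_n.+1 := lift ord0 i.

Definition out_deg (I : {set 'I_n}) (i : 'I_n) : nat :=
  (\sum_(j : 'I_n.+1 | j \notin vertex @: I) nb_edges (vertex i) j)%N.

Definition out_total (I : {set 'I_n}) : nat := (\sum_(i in I) out_deg I i)%N.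

End Graph.

(** * Ideals and graded components of quotients *)

Definition ideal_gen (R : comNzRingType) (X : finType) (P : pred X) (g : X -> R)
    (p : R) : Prop :=
  exists h : X -> R, p = \sum_(x | P x) h x * g x.

(* The classes of b_0, ..., b_(d-1) form a basis of the image of U in V / W.  *)
Definition basis_mod (K : fieldType) (V : lmodType K) (U W : V -> Prop)
    (d : nat) (b : 'I_d -> V) : Prop :=
  [/\ forall i, U (b i),
      forall v, U v -> exists c : 'I_d -> K, W (v - \sum_i c i *: b i)
    & forall c : 'I_d -> K, W (\sum_i c i *: b i) -> forall i, c i = 0].

Definition has_dim_mod (K : fieldType) (V : lmodType K) (U W : V -> Prop)
    (d : nat) : Prop :=
  exists b : 'I_d -> V, basis_mod U W b.

(* The degree k component of K[x_1, ..., x_n] / J, that is, the image in the  *)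
(* quotient of the homogeneous polynomials of degree k, has dimension d.      *)
Definition graded_dim (K : fieldType) (n : nat) (J : {mpoly K[n]} -> Prop)
    (k d : nat) : Prop :=
  has_dim_mod (fun p : {mpoly K[n]} => p \is k.-homog) J d.

Section Ideals.
Variables (K : fieldType) (n : nat) (G : multigraph n).

Definition mono_gen (I : {set 'I_n}) : {mpoly K[n]} :=
  \prod_(i in I) 'X_i ^+ out_deg G I i.

Definition power_gen (I : {set 'I_n}) : {mpoly K[n]} :=
  (\sum_(i in I) 'X_i) ^+ out_total G I.

Definition ideal_I : {mpoly K[n]} -> Prop :=
  ideal_gen (fun I : {set 'I_n} => I != set0) mono_gen.

Definition ideal_J : {mpoly K[n]} -> Prop :=
  ideal_gen (fun I : {set 'I_n} => I != set0) power_gen.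

End Ideals.

Arguments ideal_I K [n] G _.
Arguments ideal_J K [n] G _.

(** * The dimension of a graded component is well defined *)

Lemma has_dim_mod_le (K : fieldType) (V : lmodType K) (U W : V -> Prop) d d' :
    (forall (m : nat) (c : 'I_m -> K) (w : 'I_m -> V),
       (forall i, W (w i)) -> W (\sum_i c i *: w i)) ->
  has_dim_mod U W d -> has_dim_mod U W d' -> (d <= d')%N.
Proof.
move=> lcW [b [Ub _ freeb]] [b' [_ spanb' _]].
have [C WC] := fin_all_exists (fun i => spanb' _ (Ub i)).
pose A : 'M[K]_(d, d') := \matrix_(i, j) C i j.
suff: row_free A by move/eqP <-; apply: rank_leq_col.
rewrite -kermx_eq0; apply/rowV0P => u /sub_kermxP uA0.
apply/rowP => i; rewrite mxE; move: i; apply: freeb.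
have -> : \sum_i u 0 i *: b i
        = \sum_i u 0 i *: (b i - \sum_j C i j *: b' j); last exact: lcW.
under [RHS]eq_bigr => i _ do rewrite scalerBr scaler_sumr.
rewrite sumrB exchange_big /= [X in _ - X]big1 ?subr0 // => j _.
move/rowP/(_ j): uA0; rewrite !mxE => uA0.
under eq_bigr => i _ do rewrite scalerA.
rewrite -scaler_suml -[RHS](scale0r (b' j)); congr (_ *: _); rewrite -[RHS]uA0.
by apply: eq_bigr => i _; rewrite mxE.
Qed.

Lemma graded_dim_uniq (K : fieldType) (n : nat) (X : finType) (P : pred X)
    (g : X -> {mpoly K[n]}) (k d d' : nat) :
  graded_dim (ideal_gen P g) k d -> graded_dim (ideal_gen P g) k d' -> d = d'.
Proof.
have lc (m : nat) (c : 'I_m -> K) (w : 'I_m -> {mpoly K[n]}) :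
    (forall i, ideal_gen P g (w i)) -> ideal_gen P g (\sum_i c i *: w i).
  move=> /fin_all_exists [h wE]; exists (fun x => \sum_i c i *: h i x).
  under eq_bigr => i _ do rewrite wE scaler_sumr.
  rewrite exchange_big /=; apply: eq_bigr => x _; rewrite mulr_suml.
  by apply: eq_bigr => i _; rewrite scalerAl.
by move=> hd hd'; apply/eqP; rewrite eqn_leq (has_dim_mod_le lc hd hd')
  (has_dim_mod_le lc hd' hd).
Qed.

(* Main.v *)
Require Import Defs.
From mathcomp Require Import all_boot all_order all_algebra.
From mathcomp.multinomials Require Import mpoly.

Set Implicit Arguments.
Unset Strict Implicit.
Unset Printing Implicit Defensive.

Import GRing.Theory Num.Theory.
Local Open Scope ring_scope.

(* All three numbers satisfy the same deletion-contraction recursion. Removing *)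
(* the largest edge e of G, a spanning tree avoiding e has e as an externally  *)
(* passive edge (unless e is a loop), and a spanning tree through e has the    *)
(* passive edges of its contraction; so the generating polynomial P of the     *)
(* spanning trees by the number |G| - n - (activity) of passive edges obeys    *)
(* P_G = X P_(G-e) + P_(G/e). Then (1 - X)^n P_G is the probability that G is  *)
(* connected when its edges fail independently with probability X. Hence P_G   *)
(* does not depend on the order, and the recursion holds for every edge, in    *)
(* particular for an edge e from the root to a vertex v.                       *)
(*                                                                             *)
(* For such an e, a monomial outside I_G is either x_v times a monomial        *)
(* outside I_(G-e), or free of x_v and outside I_(G/e). For J_G, the sequence  *)
(* B_(G/e) -> B_G -> B_(G-e) -> 0 given by the inclusion of polynomials free   *)
(* of x_v and by d/dx_v is exact, by integration by parts. The first map is    *)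
(* injective because J_G is killed by the functionals p |-> (D_S p)(0), where  *)
(* D_S is the product over e in S of d/dx_i - d/dx_j, e = ij, and S is any set *)
(* of edges whose complement is connected; these functionals are compatible    *)
(* with both maps and suffice to separate the basis vectors.                   *)

(** * Gluing labels and the order independence of the tree count *)

(** Everything is compared with one recursive function, [ntrees]. A contracted graph is encoded by a
    labelling [r] of the vertices: vertices with equal labels are identified, and the class of the
    root carries [None]. When edges are scanned downwards, contracting those of [T], the edge
    reached is a loop exactly when larger edges of [T] join its ends. By [is_treeE] and
    [nb_trees_ntrees], [ntrees] therefore counts the spanning trees by their inactive outside edges;
    as a tree has n edges, k of these means activity |G| - n - k. The order of the edges is then
    forgotten: [rel_tree_poly] relates the generating polynomial to the reliability polynomial,
    which is visibly symmetric in the edges, whence [ntrees_perm]. So [root_edge_ind] may always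
    split along an edge e from the root to a vertex v. For A, the monomials outside the ideal are
    the parking functions, and they obey the same recursion ([parking_delete], [parking_contract],
    [parking_enum]). For B, [power_basis] joins a lift along d/dx_v of a basis for G-e to a basis
    for G/e; it spans by [power_span_antideriv] and is independent because the functionals behind
    [apolar], which kill the ideal, separate it. Integration divides by integers, so the statement
    on B assumes characteristic 0. It does fail otherwise: for a triangle in characteristic 2, (x_1
    + x_2)^2 = x_1^2 + x_2^2 adds nothing to the ideal, so x_1 x_2 survives in B but vanishes in
    A. *)

Section Labelling.
Variables (V : finType) (n : nat).
Implicit Types (r : V -> option 'I_n) (e : V * V) (s : seq (V * V)).

(* Identifies the labels of the ends of e. None is the label of the root, and *)
(* is the one that survives.                                                  *)
Definition glue r e : V -> option 'I_n := fun x =>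
  if r e.2 is Some _ then (if r x == r e.2 then r e.1 else r x)
  else (if r x == r e.1 then None else r x).

Definition one_label r := [forall x, forall y, r x == r y].

Definition nlabels r := #|[set r x | x in V]|.

Lemma glue_ends r e : glue r e e.1 = glue r e e.2.
Proof.
rewrite /glue; case E: (r e.2) => [b|]; rewrite !eqxx; first by case: eqP.
by case: eqP.
Qed.

Lemma glue_coarser r e x y : r x = r y -> glue r e x = glue r e y.
Proof. by rewrite /glue => ->. Qed.

(** The kernel of [glue r e] is the least equivalence containing the kernel of [r] and the pair [e].
    Later arguments use this instead of tracking which label survives. *)
Lemma glue_univ r e (T : Type) (g : V -> T) :
    (forall x y, r x = r y -> g x = g y) -> g e.1 = g e.2 ->
  forall x y, glue r e x = glue r e y -> g x = g y.
Proof.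
move=> rg ge x y; rewrite /glue.
by case E: (r e.2) => [b|]; rewrite -?E; do 2 case: eqP => //; move=> hx hy h;
  rewrite ?(rg _ _ hx) ?(rg _ _ hy) ?ge ?(rg _ _ h) // -ge; apply: rg; rewrite ?E.
Qed.

Lemma glue_loop r e : r e.1 = r e.2 -> glue r e =1 r.
Proof.
move=> h x; rewrite /glue; case E: (r e.2) => [b|]; first by rewrite h E; case: eqP.
by rewrite h E; case: eqP.
Qed.

Lemma nlabels_glue r e :
  r e.1 != r e.2 -> (nlabels (glue r e)).+1 = nlabels r.
Proof.
move=> ne; rewrite /nlabels.
(* [hi] is the label that disappears, [lo] the one that absorbs it. *)
pose hi := if r e.2 is Some _ then r e.2 else r e.1.
pose lo := if r e.2 is Some _ then r e.1 else r e.2.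
have mE x : glue r e x = if r x == hi then lo else r x.
  by rewrite /glue /hi /lo; case: (r e.2).
have nehl : lo != hi by rewrite /lo /hi; case: (r e.2) ne => // *; rewrite eq_sym.
have hiP : hi \in [set r x | x in V].
  by rewrite /hi; case E: (r e.2) => [b|]; rewrite -?E; apply: imset_f.
rewrite [RHS](cardsD1 hi) hiP; congr _.+1; apply: eq_card => a.
rewrite !inE; apply/imsetP/andP => [[x _ ->]|[ah /imsetP[x _ ax]]].
  rewrite mE; case: ifP => [_|->]; last by split=> //; apply: imset_f.
  by split=> //; rewrite /lo; case E: (r e.2) => [b|]; rewrite -?E; apply: imset_f.
by exists x => //; rewrite mE -ax (negPf ah).
Qed.

(* The probability that the graph obtained by gluing is connected when each  *)
(* edge is kept independently with probability 1 - 'X.                        *)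
Fixpoint rel_poly r s : {poly int} :=
  if s is e :: s' then 'X * rel_poly r s' + (1 - 'X) * rel_poly (glue r e) s'
  else (one_label r)%:R.

(* Counts the spanning trees with k externally passive edges, the edges being *)
(* listed in decreasing order.                                                *)
Fixpoint ntrees r s k : nat :=
  if s is e :: s' then
    if r e.1 == r e.2 then ntrees r s' k
    else ((if k is k'.+1 then ntrees r s' k' else 0) + ntrees (glue r e) s' k)%N
  else (k == 0) && one_label r.

Fixpoint tree_poly r s : {poly int} :=
  if s is e :: s' then
    if r e.1 == r e.2 then tree_poly r s'
    else 'X * tree_poly r s' + tree_poly (glue r e) s'
  else (one_label r)%:R.

Lemma coef_tree_poly r s k : (tree_poly r s)`_k = (ntrees r s k)%:R.
Proof.
elim: s r k => [|e s IH] r k /=.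
  by rewrite -mulnb natrM -polyC_natr coefC; case: k => [|k]; rewrite ?mul1r ?mul0r.
case: eqP => _; first exact: IH.
rewrite coefD coefXM IH natrD; by case: k => [|k] //=; rewrite IH.
Qed.

Lemma one_label_ker r r' :
  (forall x y, r x = r y <-> r' x = r' y) -> one_label r = one_label r'.
Proof.
by move=> h; apply: eq_forallb => x; apply: eq_forallb => y;
  apply/eqP/eqP => /h.
Qed.

(** Gluing the same edges in another order may change the labels but not the partition, and only the
    partition matters here. *)
Lemma rel_poly_ker r r' s :
  (forall x y, r x = r y <-> r' x = r' y) -> rel_poly r s = rel_poly r' s.
Proof.
elim: s r r' => [|e s IH] r r' h /=; first by rewrite (one_label_ker h).
congr (_ + _); first by congr (_ * _); apply: IH.
congr (_ * _); apply: IH => x y; split; apply: glue_univ => [? ? /h|];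
  by [apply: glue_coarser | apply: glue_ends].
Qed.

Lemma rel_poly_swap r e f s : rel_poly r [:: e, f & s] = rel_poly r [:: f, e & s].
Proof.
rewrite /= (@rel_poly_ker (glue (glue r e) f) (glue (glue r f) e)); last first.
  have h e' f' x y : glue (glue r e') f' x = glue (glue r e') f' y ->
      glue (glue r f') e' x = glue (glue r f') e' y.
    apply: glue_univ; last by apply/glue_coarser/glue_ends.
    apply: glue_univ; last exact: glue_ends.
    by move=> ? ? ?; do 2 apply: glue_coarser.
  by move=> x y; split; apply: h.
rewrite !mulrDr !addrA; congr (_ + _); rewrite -!addrA; congr (_ + _).
by rewrite !mulrA [X in X * _ + _]mulrC [_ * 'X]mulrC addrC.
Qed.

Lemma rel_poly_perm r s s' : perm_eq s s' -> rel_poly r s = rel_poly r s'.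
Proof.
have front e s1 s2 r1 : rel_poly r1 (s1 ++ e :: s2) = rel_poly r1 (e :: s1 ++ s2).
  elim: s1 r1 => // f s1 IH r1.
  rewrite cat_cons [in RHS]rel_poly_swap -/cat.
  by rewrite [LHS]/= !IH.
elim: s s' r => [|e s IH] s' r; first by rewrite perm_sym => /perm_nilP ->.
move=> pe; have /path.splitPr es : e \in s' by rewrite -(perm_mem pe) mem_head.
case: es pe => s1 s2; rewrite perm_sym perm_catC /= perm_cons perm_catC perm_sym => /IH h.
by rewrite front /= !h.
Qed.

(** Contracting a non-loop loses one label, which pays for the factor 1 - X in front of the
    contraction; at a loop both branches of [rel_poly] agree and their weights add up to 1. *)
Lemma rel_tree_poly r s :
  (0 < nlabels r)%N -> (1 - 'X) ^+ (nlabels r).-1 * tree_poly r s = rel_poly r s.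
Proof.
elim: s r => [|e s IH] r rpos /=.
  case c: (one_label r); rewrite ?mulr0 // mulr1.
  suff -> : nlabels r = 1%N by [].
  apply/eqP/cards1P; case/card_gt0P: rpos => a /imsetP[x _ _].
  exists (r x); apply/setP => b; rewrite inE; apply/imsetP/eqP => [[y _ ->]|->].
    by move/forallP/(_ y)/forallP/(_ x)/eqP: c.
  by exists x.
case: eqP => [loop|/eqP nloop].
  rewrite (@rel_poly_ker (glue r e) r); last by move=> x y; rewrite !glue_loop.
  by rewrite -mulrDl [in RHS]addrC subrK mul1r IH.
have nm := nlabels_glue nloop; rewrite mulrDr mulrCA IH //; congr (_ + _).
have mpos : (0 < nlabels (glue r e))%N.
  by apply/card_gt0P; exists (glue r e e.1); apply: imset_f.
by rewrite -IH // mulrA -exprS prednK // -nm.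
Qed.

(** The power of 1 - X depends on [r] alone and can be cancelled in the domain of integer
    polynomials. *)
Lemma ntrees_perm r s s' k :
  (0 < nlabels r)%N -> perm_eq s s' -> ntrees r s k = ntrees r s' k.
Proof.
move=> rpos pe; apply/eqP; rewrite -(eqr_nat int) -!coef_tree_poly.
suff -> : tree_poly r s = tree_poly r s' by [].
apply: (@mulfI _ ((1 - 'X) ^+ (nlabels r).-1)).
  by rewrite expf_neq0 // -opprB oppr_eq0 polyXsubC_eq0.
by rewrite !rel_tree_poly //; apply: rel_poly_perm.
Qed.

End Labelling.

(** * Parking functions *)

Section Rooted.
Variables (V : finType) (n : nat).
Implicit Types (r : V -> option 'I_n) (e : V * V) (s : seq (V * V)).
Implicit Types (I : {set 'I_n}) (i v : 'I_n).

Definition label_in I (a : option 'I_n) := if a is Some i then i \in I else false.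

Definition crosses r I e := label_in I (r e.1) (+) label_in I (r e.2).

Definition live r : {set 'I_n} := [set i | [exists x, r x == Some i]].

Definition rooted r := exists x, r x = None.

Definition root_edge r e v :=
  (r e.1 = None /\ r e.2 = Some v) \/ (r e.1 = Some v /\ r e.2 = None).

Lemma liveP r i : reflect (exists x, r x = Some i) (i \in live r).
Proof. by rewrite inE; apply: (iffP existsP) => -[x /eqP]; exists x => //; apply/eqP. Qed.

Lemma rooted_nlabels r : rooted r -> (0 < nlabels r)%N.
Proof. by case=> x _; apply/card_gt0P; exists (r x); apply: imset_f. Qed.

Lemma rooted_glue r e : rooted r -> rooted (glue r e).
Proof.
case=> x rx; exists x; rewrite /glue rx.
by case E: (r e.2) => [b|] //=; case: eqP.
Qed.

Lemma glue_label_in r e I x :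
  ~~ crosses r I e -> label_in I (glue r e x) = label_in I (r x).
Proof.
rewrite /crosses /glue addbC negb_add => /eqP h.
by case E: (r e.2) => [b|]; case: eqP => // ->; rewrite -?h E.
Qed.

Lemma glue_root r e v : root_edge r e v ->
  forall x, glue r e x = if r x == Some v then None else r x.
Proof. by move=> [] [h1 h2] x; rewrite /glue h2 h1. Qed.

Lemma root_edge_live r e v : root_edge r e v -> v \in live r.
Proof. by move=> [] [h1 h2]; apply/liveP; [exists e.2 | exists e.1]. Qed.

Lemma live_glue_root r e v : root_edge r e v -> live (glue r e) = live r :\ v.
Proof.
move=> h; apply/setP => i; rewrite in_setD1.
apply/liveP/andP => [[x]|[iv /liveP[x rx]]]; last first.
  by exists x; rewrite (glue_root h) rx; case: (Some i =P Some v) iv => [[->]|//]; rewrite eqxx.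
rewrite (glue_root h); case: eqP => // rv rx; split; last by apply/liveP; exists x.
by apply: contra_notN rv => /eqP <-.
Qed.

Lemma ntrees_root_edge r e v s k : root_edge r e v ->
  ntrees r (e :: s) k =
    ((if k is k'.+1 then ntrees r s k' else 0) + ntrees (glue r e) s k)%N.
Proof. by rewrite /=; case: eqP => // h [] [h1 h2]; rewrite h1 h2 in h. Qed.

Lemma ntrees_no_live r s k : rooted r -> live r = set0 -> ntrees r s k = (k == 0%N).
Proof.
move=> rr l0; have rN x : r x = None.
  by case E: (r x) => [i|] //; have: i \in live r by [apply/liveP; exists x]; rewrite l0 inE.
elim: s => [|e s IH] /=; last by rewrite !rN eqxx.
by rewrite [one_label r](_ : _ = true) ?andbT //; do 2 apply/forallP => ?; rewrite !rN.
Qed.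

(** Contracting an edge that does not cross [I] never changes whether a vertex is labelled in [I],
    so these vertices never join the root. *)
Lemma ntrees_disconnected r s k I : rooted r ->
  I :&: live r != set0 -> ~~ has (crosses r I) s -> ntrees r s k = 0%N.
Proof.
elim: s r k => [|e s IH] r k rr Ir /=.
  move=> _; suff /negPf -> : ~~ one_label r by rewrite andbF.
  apply/negP => /forallP one; case: rr => y ry.
  case/set0Pn: Ir => i /setIP[_ /liveP[x rx]].
  by have /forallP/(_ y)/eqP := one x; rewrite rx ry.
rewrite negb_or => /andP[ce cs].
have IHm : ntrees (glue r e) s k = 0%N.
  apply: IH; first exact: rooted_glue.
  - case/set0Pn: Ir => i /setIP[iI /liveP[x rx]].
    have: label_in I (glue r e x) by rewrite glue_label_in // rx.
    case E: (glue r e x) => [j|] //= jI; apply/set0Pn; exists j; rewrite inE jI.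
    by apply/liveP; exists x.
  - apply: contra cs => /hasP[f fs].
    by rewrite /crosses !glue_label_in // => cf; apply/hasP; exists f.
case: eqP => _; first exact: IH.
by rewrite IHm; case: k {IHm} => [|k]; rewrite ?IH.
Qed.

(* It suffices to delete and contract edges at the root, where contraction    *)
(* just discards a variable.                                                  *)
Lemma root_edge_ind (P : (V -> option 'I_n) -> seq (V * V) -> Prop) :
    (forall r s s', rooted r -> perm_eq s s' -> P r s -> P r s') ->
    (forall r s, rooted r -> live r = set0 -> P r s) ->
    (forall r s, rooted r -> live r != set0 ->
       ~~ has (crosses r (live r)) s -> P r s) ->
    (forall r e v s, rooted r -> root_edge r e v ->
       P r s -> P (glue r e) s -> P r (e :: s)) ->
  forall r s, rooted r -> P r s.
Proof.
move=> Pperm P0 Pdisc Pstep r s; have [m] := ubnP (size s).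
elim: m r s => // m IH r s; rewrite ltnS => sm rr.
have [l0|l0] := eqVneq (live r) set0; first exact: P0.
have [/hasP[e es ce]|] := boolP (has (crosses r (live r)) s); last exact: Pdisc.
have pe := perm_to_rem es.
apply: (Pperm _ (e :: rem e s)) => //; first by rewrite perm_sym.
have sz : (size (rem e s) < m)%N.
  by rewrite (leq_trans _ sm) // (perm_size pe).
have lv x i : r x = Some i -> i \in live r by move=> rx; apply/liveP; exists x.
(* Every label but [None] is live, so an edge crossing [live r] has the root at exactly one end. *)
have [v re] : exists v, root_edge r e v.
  move: ce; rewrite /crosses.
  case E1: (r e.1) => [i|]; case E2: (r e.2) => [j|] //=.
  - by rewrite (lv _ _ E1) (lv _ _ E2).
  - by exists i; right.
  - by exists j; left.
by apply: (Pstep _ _ v) => //; apply: IH => //; apply: rooted_glue.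
Qed.

(** * Parking functions under deletion and contraction of a root edge *)

Definition cut_deg r s I i := count (fun e =>
  ((r e.1 == Some i) && ~~ label_in I (r e.2)) ||
  ((r e.2 == Some i) && ~~ label_in I (r e.1))) s.

Definition parking r s (m : 'X_{1..n}) :=
  [forall i, (i \in live r) || (m i == 0%N)] &&
  [forall I : {set 'I_n}, (I != set0) && (I \subset live r) ==>
     [exists i in I, m i < cut_deg r s I i]%N].

Lemma parkingP r s (m : 'X_{1..n}) :
  reflect ((forall i, i \notin live r -> m i = 0%N) /\
     forall I, I != set0 -> I \subset live r ->
       exists2 i, i \in I & (m i < cut_deg r s I i)%N) (parking r s m).
Proof.
apply: (iffP andP) => -[h1 h2]; split.
- by move=> i il; have := forallP h1 i; rewrite (negPf il) => /eqP.
- move=> I I0 Il; have := forallP h2 I; rewrite I0 Il => /existsP[i /andP[]].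
  by exists i.
- by apply/forallP => i; case: (boolP (i \in live r)) => //= /h1 ->.
- apply/forallP => I; apply/implyP => /andP[I0 Il].
  by have [i iI mi] := h2 _ I0 Il; apply/existsP; exists i; rewrite iI.
Qed.

Lemma cut_deg_root_edge r e v s I i : root_edge r e v -> i \in I ->
  cut_deg r (e :: s) I i = ((v == i) + cut_deg r s I i)%N.
Proof.
move=> h iI; rewrite /cut_deg /=; congr (nat_of_bool _ + _)%N.
by case: h => [] [-> ->] /=; rewrite ?andbT ?orbF.
Qed.

Lemma label_in_glue r e v I x : root_edge r e v -> v \notin I ->
  label_in I (glue r e x) = label_in I (r x).
Proof. by move=> h vI; rewrite (glue_root h); case: eqP => // ->; rewrite /= (negPf vI). Qed.

Lemma cut_deg_glue_root r e v s I i : root_edge r e v -> v \notin I -> i \in I ->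
  cut_deg (glue r e) s I i = cut_deg r s I i.
Proof.
move=> h vI iI; apply: eq_count => f.
have em x : (glue r e x == Some i) = (r x == Some i).
  rewrite (glue_root h); case: (r x =P Some v) => // ->; apply/esym/eqP => -[vi].
  by rewrite vi iI in vI.
by rewrite !(label_in_glue _ h) // !em.
Qed.

Lemma sum_cut_deg r s I :
  (\sum_(i in I) cut_deg r s I i = count (crosses r I) s)%N.
Proof.
elim: s => [|e s IH]; first by rewrite big1.
rewrite /cut_deg /= big_split /= -/(cut_deg _ _ _) IH; congr (_ + _)%N.
have one (P : pred 'I_n) a : a \in I -> (forall i, i \in I -> P i = (a == i)) ->
    (\sum_(i in I) P i = 1)%N.
  move=> aI aP; rewrite (bigD1 a) //= aP // eqxx big1 // => i /andP[iI ia].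
  by rewrite aP // eq_sym (negPf ia).
rewrite /crosses; case Ex: (label_in I (r e.1)); case Ey: (label_in I (r e.2)) => /=.
- by rewrite big1 // => i _; rewrite !andbF.
- case: (r e.1) Ex => //= a aI; apply: (one _ a) => // i _.
  by rewrite andbT andbF orbF.
- case: (r e.2) Ey => //= a aI; apply: (one _ a) => // i _.
  by rewrite andbT andbF.
- rewrite big1 // => i iI; rewrite !andbT.
  apply/eqP; rewrite eqb0 negb_or; apply/andP; split.
    by apply: contraFneq Ex => ->.
  by apply: contraFneq Ey => ->.
Qed.

(** The edge [e] raises by one the bound on the exponent of x_v in every [I] containing [v], and no
    other bound. *)
Lemma parking_delete r e v s m : root_edge r e v ->
  parking r (e :: s) (m + U_(v))%MM = parking r s m.
Proof.
move=> h; have vl := root_edge_live h.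
have eqm i : (m + U_(v))%MM i = ((v == i) + m i)%N by rewrite mnmDE mnm1E addnC.
apply/parkingP/parkingP => -[h1 h2]; split.
- by move=> i il; have := h1 _ il; rewrite eqm => /eqP; rewrite addn_eq0 => /andP[_ /eqP].
- move=> I I0 Il; have [i iI] := h2 _ I0 Il; rewrite (cut_deg_root_edge _ h iI) eqm ltn_add2l.
  by exists i.
- move=> i il; rewrite eqm h1 // addn0; case: eqP => // vi.
  by rewrite -vi vl in il.
- move=> I I0 Il; have [i iI mi] := h2 _ I0 Il; exists i => //.
  by rewrite (cut_deg_root_edge _ h iI) eqm ltn_add2l.
Qed.

(** If x_v is absent, [v] itself is a witness for every [I] containing it, as [e] makes its bound
    positive. A set avoiding [v] has both [v] and the root outside, so merging them changes no
    bound. *)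
Lemma parking_contract r e v s m : root_edge r e v ->
  parking (glue r e) s m = (m v == 0%N) && parking r (e :: s) m.
Proof.
move=> h; have vl := root_edge_live h.
apply/parkingP/andP; rewrite (live_glue_root h) => -[h1 h2].
  have mv : m v = 0%N by apply: h1; rewrite in_setD1 eqxx.
  split; first by rewrite mv.
  apply/parkingP; split=> [i il|I I0 Il]; first by apply: h1; rewrite in_setD1 negb_and il orbT.
  have [vI|vI] := boolP (v \in I).
    by exists v => //; rewrite (cut_deg_root_edge _ h vI) mv eqxx.
  have [|i iI] := h2 _ I0; first by rewrite subsetD1 Il.
  rewrite (cut_deg_glue_root _ h) // => mi; exists i => //.
  by rewrite (cut_deg_root_edge _ h iI) (leq_trans mi) ?leq_addl.
move: h1 => /eqP mv; case/parkingP: h2 => h1 h2; split=> [i|I I0].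
  by rewrite in_setD1 negb_and negbK => /orP[/eqP -> //|]; exact: h1.
rewrite subsetD1 => /andP[Il vI]; have [i iI] := h2 _ I0 Il.
rewrite (cut_deg_root_edge _ h iI) => mi; exists i => //.
rewrite (cut_deg_glue_root _ h) //; move: mi; case: eqP => // vi.
by rewrite -vi (negPf vI) in iI.
Qed.

Lemma parking_enum r s : rooted r -> forall k, exists L : seq 'X_{1..n},
  [/\ uniq L, forall m, (m \in L) = parking r s m && (mdeg m == k)
    & size L = ntrees r s k].
Proof.
move: r s; apply: root_edge_ind.
- move=> r s s' rr pe IH k; have [L [L1 L2 L3]] := IH k; exists L; split=> //.
    move=> m; rewrite L2; congr (_ && _); congr (_ && _).
    apply: eq_forallb => I; congr (_ ==> _); apply: eq_existsb => i.
    by rewrite /cut_deg (permP pe).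
  by rewrite L3; apply: ntrees_perm => //; apply: rooted_nlabels.
- move=> r s rr l0 k; exists (nseq (k == 0%N) 0%MM).
  rewrite size_nseq ntrees_no_live //; split=> //; first by case: eqP.
  move=> m; rewrite mem_nseq lt0b; apply/andP/andP => [[/eqP -> /eqP ->]|].
    rewrite mdeg0; split=> //; apply/parkingP; rewrite l0; split=> [i _|I I0].
      by rewrite mnm0E.
    by rewrite subset0 (negPf I0).
  case=> /parkingP[]; rewrite l0 => m0 _ /eqP <-.
  have -> : m = 0%MM by apply/mnmP => i; rewrite m0 ?inE // mnm0E.
  by rewrite mdeg0 !eqxx.
- move=> r s rr l0 dis k; exists [::]; split=> //; last first.
    by rewrite (@ntrees_disconnected _ _ _ (live r)) // setIid.
  move=> m; rewrite in_nil; apply/esym/negP => /andP[/parkingP[_ /(_ _ l0 (subxx _))] [i il]].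
  suff -> : cut_deg r s (live r) i = 0%N by rewrite ltn0.
  rewrite -(count_pred0 s); apply: eq_in_count => e es; apply/negP => /= h.
  move/negP: dis; apply; apply/hasP; exists e => //; rewrite /crosses.
  by case/orP: h => /andP[/eqP -> /negPf ->] /=; rewrite il ?addbT.
- move=> r e v s rr h IH1 IH2 k; have [L2 [U2 M2 S2]] := IH2 k.
  (* These monomials will be multiplied by x_v; writing the degree condition as [(mdeg m).+1 == k]
     covers k = 0 by the empty list. *)
  have [L1 [U1 M1 S1]] : exists L1 : seq 'X_{1..n}, [/\ uniq L1,
      forall m, (m \in L1) = parking r s m && ((mdeg m).+1 == k)
      & size L1 = if k is k'.+1 then ntrees r s k' else 0%N].
    case: k {IH2 M2 S2} => [|k]; last exact: IH1.
    by exists [::]; split=> // m; rewrite andbF.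
  have inj : injective (fun m : 'X_{1..n} => (m + U_(v))%MM).
    by move=> m m' /mnmP eqm; apply/mnmP => i; have := eqm i; rewrite !mnmDE => /addIn.
  exists ([seq (m + U_(v))%MM | m <- L1] ++ L2); split.
  + rewrite cat_uniq map_inj_uniq // U1 U2 andbT; apply/hasPn => m.
    rewrite M2 (parking_contract _ _ h) => /andP[/andP[/eqP mv _] _].
    by apply/mapP => -[m' _ mE]; move: mv; rewrite mE mnmDE mnm1E eqxx addn1.
  + move=> m; rewrite mem_cat M2 (parking_contract _ _ h).
    have [mv|mv] := eqVneq (m v) 0%N.
      rewrite /= orbC; case: (_ && _) => //=; apply/negP => /mapP[m' _ mE].
      by move: mv; rewrite mE mnmDE mnm1E eqxx addn1.
    rewrite orbF; have -> : m = (m - U_(v) + U_(v))%MM.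
      by rewrite submK //; apply/mnm_lepP => i; rewrite mnm1E; case: eqP => // <-; rewrite lt0n.
    by rewrite (mem_map inj) M1 (parking_delete _ _ h) mdegD mdeg1 addn1.
  + by rewrite size_cat size_map S1 S2 (ntrees_root_edge _ _ h).
Qed.

End Rooted.

(** * Power ideals *)

Section PowerAlgebra.
Variables (K : fieldType) (V : finType) (n : nat).
Implicit Types (r : V -> option 'I_n) (e : V * V) (s : seq (V * V)).
Implicit Types (I : {set 'I_n}) (i v : 'I_n) (p q g h : {mpoly K[n]}).

(** * Differentiation and integration in the live variables *)

Definition sum_vars I : {mpoly K[n]} := \sum_(i in I) 'X_i.

Lemma mderiv_sum_vars I i : (sum_vars I)^`M(i) = (i \in I)%:R.
Proof.
rewrite /sum_vars raddf_sum /= (eq_bigr (fun j => (i == j)%:R)); last first.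
  move=> j _; rewrite mderivX mnm1E; have [->|_] := eqVneq i j.
    by rewrite scale1r -{1}[U_(j)%MM]add0m addmK mpolyX0.
  by rewrite scale0r.
have [iI|iI] := boolP (i \in I).
  rewrite (bigD1 i) //= eqxx big1 ?addr0 // => j /andP[_ ji].
  by rewrite eq_sym (negPf ji).
by rewrite big1 // => j jI; case: eqP jI iI => // -> ->.
Qed.

Lemma sum_vars_homog I : sum_vars I \is 1.-homog.
Proof. by apply: rpred_sum => i _; rewrite dhomogX /= mdeg1. Qed.

Lemma mderivXn i p m : (p ^+ m.+1)^`M(i) = m.+1%:R *: (p ^+ m * p^`M(i)).
Proof.
elim: m => [|m IH]; first by rewrite expr1 expr0 mul1r scale1r.
rewrite exprS mderivM IH -scalerAr mulrA -exprS [_ * p ^+ _]mulrC.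
by rewrite -[X in X + _]scale1r -scalerDl -[1]/(1%:R) -natrD add1n.
Qed.

Lemma mderiv_homog i d p : p \is d.+1.-homog -> p^`M(i) \is d.-homog.
Proof.
move=> /dhomogP hp; apply/dhomogP => m; rewrite mcoeff_msupp mcoeff_deriv => mp.
have /hp : (m + U_(i))%MM \in msupp p.
  by rewrite mcoeff_msupp; apply: contraNneq mp => ->; rewrite mul0rn.
by rewrite /= mdegD mdeg1 addn1 => -[].
Qed.

Lemma mderiv_homog0 i p : p \is 0.-homog -> p^`M(i) = 0.
Proof.
move=> hp; apply/mpolyP => m; rewrite mcoeff_deriv mcoeff0.
by rewrite (dhomog_nemf_coeff hp) ?mul0rn //= mdegD mdeg1 addn1.
Qed.

(* In characteristic 0: p only involves the variables of live labels. *)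
Definition live_poly r p := forall i, i \notin live r -> p^`M(i) = 0.

Lemma live_polyD r p q : live_poly r p -> live_poly r q -> live_poly r (p + q).
Proof. by move=> hp hq i il; rewrite mderivD hp ?hq ?addr0. Qed.

Lemma live_polyZ r c p : live_poly r p -> live_poly r (c *: p).
Proof. by move=> hp i il; rewrite mderivZ hp ?scaler0. Qed.

Lemma live_polyB r p q : live_poly r p -> live_poly r q -> live_poly r (p - q).
Proof. by move=> hp hq i il; rewrite mderivB hp ?hq ?subr0. Qed.

Lemma live_polyM r p q : live_poly r p -> live_poly r q -> live_poly r (p * q).
Proof. by move=> hp hq i il; rewrite mderivM hp ?hq ?mul0r ?mulr0 ?addr0. Qed.

Lemma live_polyX r p m : live_poly r p -> live_poly r (p ^+ m).
Proof.
move=> hp; elim: m => [|m IH]; last by rewrite exprS; apply: live_polyM.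
by move=> i _; rewrite expr0 -mpolyC1 mderivC.
Qed.

Lemma live_poly_sum r (X : finType) (F : X -> {mpoly K[n]}) :
  (forall x, live_poly r (F x)) -> live_poly r (\sum_x F x).
Proof. by move=> hF i il; rewrite raddf_sum /= big1 // => x _; apply: hF. Qed.

Lemma live_poly_deriv r p i : live_poly r p -> live_poly r p^`M(i).
Proof. by move=> hp j jl; rewrite mderiv_comm hp ?mderiv0. Qed.

Lemma live_poly_sum_vars r I : I \subset live r -> live_poly r (sum_vars I).
Proof.
move=> Il i il; rewrite mderiv_sum_vars; case: (boolP (i \in I)) => // /(subsetP Il).
by rewrite (negPf il).
Qed.

Lemma live_poly_glue r e v p : root_edge r e v ->
  live_poly (glue r e) p <-> live_poly r p /\ p^`M(v) = 0.
Proof.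
move=> h; split=> [hp|[hp pv] i]; last first.
  by rewrite (live_glue_root h) in_setD1 negb_and negbK => /orP[/eqP -> //|]; apply: hp.
split=> [i il|]; apply: hp; rewrite (live_glue_root h) in_setD1 negb_and ?il ?orbT //.
by rewrite eqxx.
Qed.

Section CharZero.
Hypothesis char0 : [pchar K] =i pred0.

Lemma natS_neq0 m : m.+1%:R != 0 :> K.
Proof. by rewrite (proj1 (pcharf0P K) char0). Qed.

(* Repeated integration by parts. *)
Lemma antideriv_mul_sum_vars r I v d m h : v \in I -> I \subset live r ->
    h \is d.-homog -> live_poly r h ->
  exists g, [/\ g \is d.-homog, live_poly r g
    & (g * sum_vars I ^+ m.+1)^`M(v) = h * sum_vars I ^+ m].
Proof.
move=> vI Il; elim: d m h => [|d IH] m h hh lh.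
  exists (m.+1%:R^-1 *: h); split; [exact: dhomogZ|exact: live_polyZ|].
  rewrite mderivM mderivZ mderiv_homog0 // scaler0 mul0r add0r mderivXn.
  rewrite mderiv_sum_vars vI mulr1 -scalerAl -scalerAr scalerA mulVf ?scale1r //.
  exact: natS_neq0.
have [g [gh lg gE]] := IH m.+1 _ (mderiv_homog v hh) (live_poly_deriv v lh).
(* With s = [sum_vars I], the derivative of h s^(m+1) is h' s^(m+1) + (m+1) h s^m; the induction on
   the degree of h integrates the first term as g s^(m+2). *)
exists (m.+1%:R^-1 *: (h - g * sum_vars I)); split.
- apply: dhomogZ; apply: rpredB => //; rewrite -addn1; apply: dhomogM => //.
  exact: sum_vars_homog.
- by apply/live_polyZ/live_polyB => //; apply: live_polyM => //; apply: live_poly_sum_vars.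
rewrite -scalerAl mderivZ mulrBl -mulrA -exprS mderivB gE mderivM addrAC subrr add0r.
rewrite mderivXn mderiv_sum_vars vI mulr1 -scalerAr scalerA mulVf ?scale1r //.
exact: natS_neq0.
Qed.

(** The case [I = [set v]], m = 0 of the previous lemma, where the linear form is x_v. *)
Lemma antideriv r v d p : v \in live r -> p \is d.-homog -> live_poly r p ->
  exists g, [/\ g \is d.+1.-homog, live_poly r g & g^`M(v) = p].
Proof.
move=> vl ph lp; have vv : v \in [set v] by rewrite inE.
have sv : [set v] \subset live r by rewrite sub1set.
have [g [gh lg gE]] := antideriv_mul_sum_vars 0 vv sv ph lp.
exists (g * sum_vars [set v]); split.
- by rewrite -addn1; apply: dhomogM => //; apply: sum_vars_homog.
- by apply: live_polyM => //; apply: live_poly_sum_vars.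
- by rewrite expr1 expr0 mulr1 in gE.
Qed.

Lemma no_live_const p : (forall i, p^`M(i) = 0) -> p = (p@_0%MM)%:MP.
Proof.
move=> hp; apply/mpolyP => m; rewrite mcoeffC; have [->|m0] := eqVneq m 0%MM.
  by rewrite mulr1.
rewrite mulr0; have [i mi] : exists i, m i != 0%N.
  apply/existsP; apply: contraNT m0; rewrite negb_exists => /forallP m0.
  by apply/eqP/mnmP => i; rewrite mnm0E; apply/eqP; rewrite -[_ == _]negbK.
have mE : m = (m - U_(i) + U_(i))%MM.
  by rewrite submK //; apply/mnm_lepP => j; rewrite mnm1E; case: eqP => // <-; rewrite lt0n.
have := congr1 (mcoeff (m - U_(i))%MM) (hp i).
rewrite mcoeff_deriv -mE mcoeff0 -mulr_natr => /eqP.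
by rewrite mulf_eq0 (negPf (natS_neq0 _)) orbF => /eqP.
Qed.

End CharZero.

(** The degree k part of the power ideal of the contracted graph, in live variables. Homogeneous
    live cofactors are kept explicit so that a member can be integrated term by term. *)
Inductive power_span r s k : {mpoly K[n]} -> Prop :=
| PowerSpan0 : power_span r s k 0
| PowerSpanS I h d q of I != set0 & I \subset live r & live_poly r h
    & h \is d.-homog & (d + count (crosses r I) s)%N = k & power_span r s k q :
  power_span r s k (h * sum_vars I ^+ count (crosses r I) s + q).

Lemma power_spanD r s k p q :
  power_span r s k p -> power_span r s k q -> power_span r s k (p + q).
Proof.
move=> hp hq; elim: hp => [|I h d p' I0 Il lh hh dk _ IH]; first by rewrite add0r.
by rewrite -addrA; apply: PowerSpanS hh _ _.
Qed.

Lemma power_span_perm r s s' k p :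
  perm_eq s s' -> power_span r s k p -> power_span r s' k p.
Proof.
move=> pe; elim=> [|I h d p' I0 Il lh hh dk _ IH]; first exact: PowerSpan0.
by rewrite (permP pe) in dk *; apply: PowerSpanS hh _ _.
Qed.

Lemma count_crosses_root r e v s I : root_edge r e v ->
  count (crosses r I) (e :: s) = ((v \in I) + count (crosses r I) s)%N.
Proof.
by move=> h /=; rewrite /crosses; case: h => [] [-> ->] /=; rewrite ?addbF.
Qed.

(** The generators for G/e are those of G whose [I] avoids [v]: such an [I] is not crossed by [e],
    so the exponent is the same. *)
Lemma power_span_contract r e v s k p : root_edge r e v ->
  power_span (glue r e) s k p -> power_span r (e :: s) k p.
Proof.
move=> h; elim=> [|I g d p' I0]; first exact: PowerSpan0.
rewrite (live_glue_root h) subsetD1 => /andP[Il vI] /(live_poly_glue _ h)[lg _] hg dk _ IH.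
have cE : count (crosses (glue r e) I) s = count (crosses r I) (e :: s).
  rewrite (count_crosses_root _ _ h) (negPf vI).
  by apply: eq_count => f; rewrite /crosses !(label_in_glue _ h).
by rewrite cE in dk *; apply: PowerSpanS hg _ _.
Qed.

(** Exactness in the middle: d/dx_v maps J_G onto J_(G-e). If [I] contains [v], its exponent grows
    by one with [e] and integration by parts applies; otherwise the power is constant in x_v and
    only the cofactor is integrated. *)
Lemma power_span_antideriv r e v s k p : [pchar K] =i pred0 -> root_edge r e v ->
    power_span r s k p ->
  exists q, [/\ power_span r (e :: s) k.+1 q, q \is k.+1.-homog, live_poly r q
    & q^`M(v) = p].
Proof.
move=> char0 h; elim=> [|I g d p' I0 Il lg hg dk _ [q [sq hq lq qE]]].
  exists 0; rewrite mderiv0 rpred0; split=> //; first exact: PowerSpan0.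
  by move=> i _; rewrite mderiv0.
have cE := count_crosses_root s I h.
suff [d' [f [hf lf d'E fE]]] : exists d' f, [/\ f \is d'.-homog, live_poly r f,
    (d' + count (crosses r I) (e :: s) = k.+1)%N
    & (f * sum_vars I ^+ count (crosses r I) (e :: s))^`M(v)
      = g * sum_vars I ^+ count (crosses r I) s].
  exists (f * sum_vars I ^+ count (crosses r I) (e :: s) + q); split.
  - exact: PowerSpanS hf d'E sq.
  - apply: rpredD => //; rewrite -d'E; apply: dhomogM => //.
    by rewrite -[X in X.-homog]mul1n; apply/dhomogMn/sum_vars_homog.
  - by apply: live_polyD => //; apply: live_polyM => //; apply/live_polyX/live_poly_sum_vars.
  - by rewrite mderivD fE qE.
rewrite cE; have [vI|vI] := boolP (v \in I).
  have [f [hf lf fE]] := antideriv_mul_sum_vars char0 (count (crosses r I) s) vI Il hg lg.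
  by exists d, f; split=> //; rewrite add1n addnS dk.
have [f [hf lf fE]] := antideriv char0 (root_edge_live h) hg lg.
exists d.+1, f; split=> //; first by rewrite addSn dk.
rewrite add0n mderivM fE.
suff -> : (sum_vars I ^+ count (crosses r I) s)^`M(v) = 0 by rewrite mulr0 addr0.
case: (count _ _) => [|c]; first by rewrite expr0 -mpolyC1 mderivC.
by rewrite mderivXn mderiv_sum_vars (negPf vI) mulr0 scaler0.
Qed.

(** * Differential functionals that kill the power ideal *)

Definition label_deriv (a : option 'I_n) p := if a is Some i then p^`M(i) else 0.

Definition edge_deriv r e p := label_deriv (r e.1) p - label_deriv (r e.2) p.

Definition edges_deriv r s p := foldl (fun q e => edge_deriv r e q) p s.

Lemma label_derivD a p q : label_deriv a (p + q) = label_deriv a p + label_deriv a q.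
Proof. by case: a => [i|] /=; rewrite ?mderivD ?addr0. Qed.

Lemma edge_derivD r e p q : edge_deriv r e (p + q) = edge_deriv r e p + edge_deriv r e q.
Proof. by rewrite /edge_deriv !label_derivD opprD addrACA. Qed.

Lemma edges_derivD r s p q :
  edges_deriv r s (p + q) = edges_deriv r s p + edges_deriv r s q.
Proof. by elim: s p q => //= e s IH p q; rewrite edge_derivD IH. Qed.

Lemma edges_deriv0 r s : edges_deriv r s 0 = 0.
Proof.
have := edges_derivD r s 0 0; rewrite addr0 => /eqP.
by rewrite -subr_eq subrr eq_sym => /eqP.
Qed.

Lemma edges_derivN r s p : edges_deriv r s (- p) = - edges_deriv r s p.
Proof. by apply/eqP; rewrite -addr_eq0 -edges_derivD addrC subrr edges_deriv0. Qed.

Definition spanning r s :=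
  forall I, I :&: live r != set0 -> has (crosses r I) s.

(* The polynomials orthogonal, for the pairing (p, q) |-> q(d/dx) p (0), to   *)
(* all products over S of the forms x_i - x_j, for S with spanning complement.*)
Definition apolar r s p := forall S U,
  perm_eq (S ++ U) s -> spanning r U -> (edges_deriv r S p)@_0%MM = 0.

Lemma apolar_perm r s s' p : perm_eq s s' -> apolar r s p -> apolar r s' p.
Proof. by move=> pe op S U pSU; apply: op; apply: perm_trans pSU _; rewrite perm_sym. Qed.

(** Put [e] into S: its operator is d/dx_v up to sign, and U is unchanged. *)
Lemma apolar_delete r e v s p : root_edge r e v ->
  apolar r (e :: s) p -> apolar r s p^`M(v).
Proof.
move=> h op S U pSU sU.
have := op (e :: S) U; rewrite cat_cons perm_cons => /(_ pSU sU).
rewrite /= /edge_deriv; case: h => [] [-> ->] /=; rewrite ?subr0 //.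
by rewrite sub0r edges_derivN mcoeffN => /eqP; rewrite oppr_eq0 => /eqP.
Qed.

Lemma label_deriv_comm a i p : (label_deriv a p)^`M(i) = label_deriv a p^`M(i).
Proof. by case: a => [j|] /=; rewrite ?mderiv0 // mderiv_comm. Qed.

(** Put [e] into U: it crosses every set containing [v], so U need only be spanning after
    contraction. Since p is free of x_v, sending x_v to the root changes no derivative. *)
Lemma apolar_contract r e v s p : root_edge r e v -> p^`M(v) = 0 ->
  apolar r (e :: s) p -> apolar (glue r e) s p.
Proof.
move=> h pv op S U pSU sU.
suff -> : edges_deriv (glue r e) S p = edges_deriv r S p.
  apply: (op S (e :: U)).
    by rewrite -cat1s perm_catCA perm_cons.
  move=> I IL /=; have [vI|vI] := boolP (v \in I).
    by rewrite {1}/crosses; case: h => [] [-> ->] /=; rewrite vI.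
  apply/orP; right; have /hasP[f fU cf] : has (crosses (glue r e) I) U.
    apply: sU; case/set0Pn: IL => i /setIP[iI il]; apply/set0Pn; exists i.
    rewrite inE iI (live_glue_root h) in_setD1 il andbT.
    by apply: contraNneq vI => <-.
  by apply/hasP; exists f => //; move: cf; rewrite /crosses !(label_in_glue _ h).
elim: S p pv {pSU op} => //= f S IH p pv.
have lE x : label_deriv (glue r e x) p = label_deriv (r x) p.
  by rewrite (glue_root h); case: eqP => // ->; rewrite /= pv.
rewrite /edge_deriv !lE; apply: IH.
rewrite mderivB !label_deriv_comm pv.
by case: (r f.1); case: (r f.2) => * /=; rewrite ?mderiv0 subrr.
Qed.

(** The operator of an edge not crossing [I] kills [sum_vars I], its two partial derivatives
    cancelling; a crossing edge costs at most one power. *)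
Lemma edges_deriv_power r I S m h : exists g,
  edges_deriv r S (h * sum_vars I ^+ (m + count (crosses r I) S))
    = g * sum_vars I ^+ m.
Proof.
have step e c p : exists g, edge_deriv r e (p * sum_vars I ^+ (crosses r I e + c))
                              = g * sum_vars I ^+ c.
  have stepl a k q : exists g, label_deriv a (q * sum_vars I ^+ k.+1) = g * sum_vars I ^+ k.
    case: a => [i|] /=; last by exists 0; rewrite mul0r.
    exists (q^`M(i) * sum_vars I + k.+1%:R *: (q * (sum_vars I)^`M(i))).
    rewrite mderivM mderivXn mulrDl exprS mulrA -scalerAl -scalerAr; congr (_ + _ *: _).
    by rewrite -mulrA; congr (_ * _); rewrite mulrC.
  have derX a : label_deriv a (sum_vars I) = (label_in I a)%:R.
    by case: a => [i|] //=; apply: mderiv_sum_vars.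
  case: (boolP (crosses r I e)) => [_|ncr].
    have [g1 E1] := stepl (r e.1) c p; have [g2 E2] := stepl (r e.2) c p.
    by exists (g1 - g2); rewrite /edge_deriv add1n E1 E2 mulrBl.
  rewrite add0n; have derM a : label_deriv a (p * sum_vars I ^+ c) =
      label_deriv a p * sum_vars I ^+ c + (label_in I a)%:R * (c%:R *: (p * sum_vars I ^+ c.-1)).
    case: a => [i|] /=; last by rewrite !mul0r addr0.
    rewrite mderivM; congr (_ + _); case: c => [|c].
      by rewrite expr0 -mpolyC1 mderivC mulr0 scale0r mulr0.
    by rewrite mderivXn mderiv_sum_vars -scalerAr -scalerAr mulrA [in RHS]mulrC.
  exists (edge_deriv r e p); rewrite /edge_deriv !derM.
  move: ncr; rewrite /crosses negb_add => /eqP ->.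
  by rewrite mulrBl opprD addrACA subrr addr0.
elim: S m h => [|e S IH] m h; first by exists h; rewrite addn0.
rewrite /= addnCA; have [g ->] := step e (m + count (crosses r I) S)%N h.
exact: IH.
Qed.

Lemma apolarD r s p q : apolar r s p -> apolar r s q -> apolar r s (p + q).
Proof. by move=> hp hq S U pSU sU; rewrite edges_derivD mcoeffD (hp S U) ?(hq S U) ?addr0. Qed.

Lemma apolar0 r s : apolar r s 0.
Proof. by move=> S U _ _; rewrite edges_deriv0 mcoeff0. Qed.

(** After applying S, a power with exponent the number of edges of U crossing [I] remains. It is
    positive as U is spanning, so the value at 0 vanishes. *)
Lemma apolar_power r s I h : I :&: live r != set0 ->
  apolar r s (h * sum_vars I ^+ count (crosses r I) s).
Proof.
move=> Il S U pSU sU; rewrite -(permP pSU) count_cat addnC.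
have [g ->] := edges_deriv_power r I S (count (crosses r I) U) h.
have := sU _ Il; rewrite has_count; case: (count _ U) => // m _.
have X0 : (sum_vars I)@_0%MM = 0.
  by apply: (dhomog_nemf_coeff (sum_vars_homog I)); rewrite /= mdeg0.
by rewrite exprS mulrCA (rmorphM (mcoeff 0%MM)) /= X0 mul0r.
Qed.

(** Independence is stated modulo [apolar] rather than modulo the ideal because apolarity visibly
    passes to G-e and G/e; that is what makes the map from B_(G/e) to B_G injective. *)
Lemma power_basis r s : [pchar K] =i pred0 -> rooted r -> forall k,
  exists (X : finType) (b : X -> {mpoly K[n]}),
  [/\ #|X| = ntrees r s k,
      forall x, b x \is k.-homog /\ live_poly r (b x),
      forall p, p \is k.-homog -> live_poly r p ->
        exists c : X -> K, power_span r s k (p - \sum_x c x *: b x)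
    & forall c : X -> K, apolar r s (\sum_x c x *: b x) -> forall x, c x = 0].
Proof.
move=> char0; move: r s; apply: root_edge_ind.
- move=> r s s' rr pe IH k; have [X [b [b1 b2 b3 b4]]] := IH k; exists X, b; split=> //.
  + by rewrite b1; apply: ntrees_perm => //; apply: rooted_nlabels.
  + by move=> p hp lp; have [c cP] := b3 p hp lp; exists c; apply: power_span_perm cP.
  + by move=> c oc; apply: b4; apply: apolar_perm oc; rewrite perm_sym.
- move=> r s rr l0 k; exists 'I_(k == 0%N), (fun _ => 1); split.
  + by rewrite card_ord ntrees_no_live.
  + move=> x; split; last by move=> i _; rewrite -mpolyC1 mderivC.
    by case: k x => [|k] [x xk] //; apply: dhomog1.
  + move=> p hp lp; exists (fun _ => p@_0%MM).
    have {lp}pE : p = (p@_0%MM)%:MP.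
      by apply: (no_live_const char0) => i; apply: lp; rewrite l0 in_set0.
    set q := (X in power_span _ _ _ X); suff -> : q = 0 by exact: PowerSpan0.
    rewrite {}/q.
    case: k hp => [|k] hp /=.
      by rewrite big_ord_recl big_ord0 addr0 {1}pE -mul_mpolyC mulr1 subrr.
    rewrite big_ord0 subr0 pE (dhomog_nemf_coeff hp) ?mpolyC0 //=.
    by rewrite mdeg0.
  + move=> c oc x; have := oc [::] s (perm_refl _); rewrite /=.
    have sp : spanning r s by move=> I; rewrite l0 setI0 eqxx.
    move/(_ sp); case: k c {oc} x => [|k] c [x xk] //=.
    rewrite big_ord_recl big_ord0 addr0 mcoeffZ mcoeff1 eqxx mulr1 => c0.
    by rewrite -[RHS]c0; congr c; apply: val_inj; case: x xk.
- move=> r s rr l0 dis k; exists void, (fun _ => 0); split=> //.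
  + by rewrite card_void (@ntrees_disconnected _ _ _ _ _ (live r)) // setIid.
  + move=> p hp lp; exists (fun _ => 0); rewrite big1 ?subr0; last by case.
    have c0 : count (crosses r (live r)) s = 0%N.
      by apply/eqP; rewrite eqn0Ngt -has_count.
    have dk : (k + count (crosses r (live r)) s)%N = k by rewrite c0 addn0.
    have := PowerSpanS l0 (subxx _) lp hp dk (PowerSpan0 _ _ _).
    by rewrite c0 expr0 mulr1 addr0.
- move=> r e v s rr h IH1 IH2 k; have [X2 [b2 [N2 H2 S2 F2]]] := IH2 k.
  have vl := root_edge_live h.
  (* In degree 0 every polynomial is free of x_v, so only the contraction contributes. *)
  case: k N2 H2 S2 F2 {IH2} => [|k] N2 H2 S2 F2.
    exists X2, b2; split=> //.
    + by rewrite (ntrees_root_edge _ _ h) N2.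
    + by move=> x; have [hx /(live_poly_glue _ h)[]] := H2 x.
    + move=> p hp lp; have [|c cP] := S2 p hp.
        by apply/(live_poly_glue _ h); split=> //; apply: mderiv_homog0.
      by exists c; exact: power_span_contract h cP.
    + move=> c oc; apply: F2; apply: (apolar_contract h) oc.
      apply: mderiv_homog0; apply: rpred_sum => x _; apply: rpredZ.
      by have [] := H2 x.
  have [X1 [b1 [N1 H1 S1 F1]]] := IH1 k.
  have /fin_all_exists[a aP] x : exists g, [/\ g \is k.+1.-homog, live_poly r g & g^`M(v) = b1 x].
    by have [hx lx] := H1 x; apply: antideriv.
  pose b (x : X1 + X2) := match x with inl x1 => a x1 | inr x2 => b2 x2 end.
  have bE (c : X1 + X2 -> K) : \sum_x c x *: b x =
      \sum_x c (inl x) *: a x + \sum_x c (inr x) *: b2 x by rewrite big_sumType.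
  have db2 (c : X2 -> K) : (\sum_x c x *: b2 x)^`M(v) = 0.
    rewrite raddf_sum /= big1 // => x _; rewrite mderivZ.
    by have [_ /(live_poly_glue _ h)[_ ->]] := H2 x; rewrite scaler0.
  have da (c : X1 -> K) : (\sum_x c x *: a x)^`M(v) = \sum_x c x *: b1 x.
    by rewrite raddf_sum /=; apply: eq_bigr => x _; rewrite mderivZ; have [_ _ ->] := aP x.
  exists (X1 + X2)%type, b; split.
  + by rewrite card_sum N1 N2 (ntrees_root_edge _ _ h).
  + case=> x /=; first by have [] := aP x.
    by have [hx /(live_poly_glue _ h)[]] := H2 x.
  + move=> p hp lp.
    have [c1 c1P] := S1 _ (mderiv_homog v hp) (live_poly_deriv v lp).
    (* Subtracting the lifts [a] and an element [j] of the ideal from p leaves [t] killed by d/dx_v,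
       hence a polynomial of G/e. *)
    have [j [sj hj lj jE]] := power_span_antideriv char0 h c1P.
    pose t := p - \sum_x c1 x *: a x - j.
    have ht : t \is k.+1.-homog.
      apply: rpredB => //; apply: rpredB => //; apply: rpred_sum => x _.
      by apply: rpredZ; have [] := aP x.
    have lt : live_poly (glue r e) t.
      apply/(live_poly_glue _ h); split.
        apply: live_polyB => //; apply: live_polyB => //; apply: live_poly_sum => x.
        by apply: live_polyZ; have [] := aP x.
      by rewrite mderivB jE mderivB da subrr.
    have [c2 c2P] := S2 _ ht lt.
    exists (fun x => match x with inl x1 => c1 x1 | inr x2 => c2 x2 end); rewrite bE.
    have -> : p - (\sum_x c1 x *: a x + \sum_x c2 x *: b2 x) = j + (t - \sum_x c2 x *: b2 x).
      by rewrite /t [in RHS]addrA [j + _]addrC subrK opprD addrA.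
    by apply: power_spanD => //; exact: power_span_contract h c2P.
  + move=> c; rewrite bE => oc.
    (* Applying d/dx_v erases the part coming from G/e. *)
    have c1 : forall x, c (inl x) = 0.
      apply: F1; have := apolar_delete h oc.
      by rewrite mderivD (da (fun x => c (inl x))) (db2 (fun x => c (inr x))) addr0.
    case=> x //; move: x; apply: F2; apply: (apolar_contract h) => //.
    by move: oc; rewrite big1 ?add0r // => x _; rewrite c1 scale0r.
Qed.

End PowerAlgebra.

(** * Spanning trees and external activity *)

Lemma set2_inj (T : finType) (a b u v : T) : [set a; b] = [set u; v] ->
  (a = u /\ b = v) \/ (a = v /\ b = u).
Proof.
move=> E; have /set2P ha : a \in [set u; v] by rewrite -E set21.
have /set2P hb : b \in [set u; v] by rewrite -E set22.
have /set2P hu : u \in [set a; b] by rewrite E set21.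
have /set2P hv : v \in [set a; b] by rewrite E set22.
by intuition (subst; auto).
Qed.

Section Cycles.
Variables (n : nat) (G : multigraph n).
Implicit Types (e f : edge G) (S T C F : {set edge G}).

Lemma ends_pair e : exists p : 'I_n.+1 * 'I_n.+1, ends e == [set p.1; p.2].
Proof.
have /andP[] := ends_card e; case E: #|ends e| => [|[|[|//]]] // _ _.
  by move/eqP/cards1P: E => [x ->]; exists (x, x); rewrite setUid.
by move/eqP/cards2P: E => [x [y [_ ->]]]; exists (x, y).
Qed.

Definition endpoints e := xchoose (ends_pair e).

Lemma joins_endpoints e : joins e (endpoints e).1 (endpoints e).2.
Proof. exact: (xchooseP (ends_pair e)). Qed.

Lemma joinsC e u v : joins e u v = joins e v u.
Proof. by rewrite /joins setUC. Qed.

Lemma joinsE e u v : joins e u v ->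
  (u = (endpoints e).1 /\ v = (endpoints e).2) \/
  (u = (endpoints e).2 /\ v = (endpoints e).1).
Proof. by move=> /eqP h; apply: set2_inj; rewrite -h; apply/eqP/joins_endpoints. Qed.

Lemma adjacent_in_connect_sym S : connect_sym (adjacent_in S).
Proof. by apply: sym_connect_sym => u v /=; apply: eq_existsb => e; rewrite joinsC. Qed.

Lemma graph_cycleI C k (v : 'I_k -> 'I_n.+1) (f : 'I_k -> edge G) :
    (0 < k)%N -> injective v -> injective f -> f @: setT = C ->
    (forall i, joins (f i) (v i) (v (ordS i))) ->
  graph_cycle C.
Proof.
move=> k0 vI fI fC jf; have kC : #|C| = k.
  by rewrite -fC card_imset // cardsT card_ord.
subst k; rewrite /graph_cycle k0; apply/existsP; exists (finfun v).
apply/existsP; exists (finfun f); apply/and3P; split.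
- by apply/injectiveP => i j; rewrite !ffunE => /vI.
- by apply/eqP; apply: etrans fC; apply: eq_imset => i; rewrite ffunE.
- by apply/forallP => i; rewrite !ffunE.
Qed.

Lemma val_iter_ordS k (i : 'I_k) j : val (iter j (@ordS k) i) = ((i + j) %% k)%N.
Proof.
elim: j => [|j IH] /=; first by rewrite addn0 modn_small.
by rewrite IH -addn1 modnDml addn1 addnS.
Qed.

Lemma graph_cycle_connect C e : graph_cycle C -> e \in C ->
  connect (adjacent_in (C :\ e)) (endpoints e).1 (endpoints e).2.
Proof.
move=> /andP[k0 /existsP[v /existsP[f /and3P[/injectiveP vI /eqP fC /forallP jf]]]].
move=> eC; have fI : injective f.
  have /imset_injP fI : #|f @: setT| == #|[set: 'I_#|C|]| by rewrite {1}fC cardsT card_ord.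
  by move=> i j; apply: fI; rewrite inE.
have /imsetP[i0 _ ei0] : e \in f @: setT by rewrite fC.
have fiC i : f i \in C.
  by have := imset_f f (in_setT i); move: (f i) => g; rewrite fC.
have conn j : (j < #|C|)%N -> connect (adjacent_in (C :\ e)) (v (ordS i0))
    (v (iter j.+1 (@ordS _) i0)).
  elim: j => [|j IH] jk; first exact: connect0.
  apply: connect_trans (IH (ltnW jk)) _; apply: connect1; apply/existsP.
  exists (f (iter j.+1 (@ordS _) i0)); rewrite jf andbT in_setD1 fiC andbT.
  rewrite ei0 (inj_eq fI) -val_eqE val_iter_ordS; apply/eqP => h.
  have : (i0 + j.+1 == i0 + 0 %[mod #|C|])%N by rewrite addn0 h modn_small.
  by rewrite eqn_modDl mod0n modn_small.
have := conn (#|C|.-1); rewrite prednK // leqnn => /(_ isT).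
have -> : iter #|C| (@ordS _) i0 = i0.
  by apply: val_inj; rewrite val_iter_ordS modnDr modn_small.
have := jf i0; rewrite -ei0 => /joinsE[] [-> ->] //.
by rewrite adjacent_in_connect_sym.
Qed.

(** A simple path in S between the ends of [e], closed up by [e]. *)
Lemma connect_graph_cycle S e : e \notin S ->
    connect (adjacent_in S) (endpoints e).1 (endpoints e).2 ->
  exists C, [/\ graph_cycle C, e \in C & C :\ e \subset S].
Proof.
move=> eS /connectP[p0 path0 last0].
move: last0; case/shortenP: path0 => p pp up _ lastp {p0}.
set a := (endpoints e).1 in pp up lastp.
pose v (i : 'I_(size p).+1) := nth a (a :: p) i.
(* The last index carries the closing edge [e]; below it the default of [odflt] is never reached,
   since consecutive path vertices are adjacent in S. *)
pose f (i : 'I_(size p).+1) : edge G :=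
  if (i < size p)%N
  then odflt e [pick g in S | joins g (nth a (a :: p) i) (nth a (a :: p) i.+1)]
  else e.
have fS (i : 'I_(size p).+1) : (i < size p)%N ->
    f i \in S /\ joins (f i) (nth a (a :: p) i) (nth a (a :: p) i.+1).
  move=> ip; rewrite /f ip; case: pickP => [g /andP[]//|no].
  have /existsP[g gP] := pathP a pp i ip.
  by have := no g; rewrite gP.
have fe (i : 'I_(size p).+1) : ~~ (i < size p)%N -> f i = e.
  by move=> ip; rewrite /f (negPf ip).
have fI : injective f.
  have aux (i j : 'I_(size p).+1) : (i < j)%N -> f i != f j.
    move=> ij; have ip : (i < size p)%N by apply: leq_trans ij _; rewrite -ltnS.
    have [fiS /eqP ji] := fS _ ip; have [jp|jp] := boolP (j < size p)%N; last first.
      by rewrite (fe j jp); apply: contraNneq eS => <-.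
    have [_ /eqP jj] := fS _ jp; apply/eqP => fij; move: ji; rewrite fij jj.
    move/esym/set2_inj => [] [/eqP + _]; rewrite nth_uniq //= ?ltnS ?(ltnW ip) ?(ltnW jp) //.
      by rewrite ltn_eqF.
    by rewrite ltn_eqF // ltnW.
  move=> i j fij; apply: val_inj; have [ij|ij|//] := ltngtP (val i) (val j).
    by have := aux _ _ ij; rewrite fij eqxx.
  by have := aux _ _ ij; rewrite fij eqxx.
have vI : injective v.
  by move=> i j /eqP; rewrite nth_uniq //= => /eqP; apply: val_inj.
exists (f @: setT); split.
- apply: (@graph_cycleI _ (size p).+1 v f) => // i; rewrite /v /=.
  have [ip|ip] := boolP (i < size p)%N.
    by have [_] := fS _ ip; rewrite modn_small.
  have -> : val i = size p by apply/eqP; rewrite eqn_leq -ltnS ltn_ord leqNgt.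
  rewrite modnn fe // (nth_last a (a :: p)) /= -lastp joinsC.
  exact: joins_endpoints.
- by apply/imsetP; exists ord_max => //; rewrite fe //= ltnn.
- apply/subsetP => g; rewrite in_setD1 => /andP[ge /imsetP[i _ gi]].
  have [ip|ip] := boolP (i < size p)%N; first by rewrite gi; have [] := fS _ ip.
  by rewrite gi fe // eqxx in ge.
Qed.

(** * External activity as connectivity by larger edges *)

Section Activity.
Variable le : rel (edge G).
Hypotheses (le_refl : reflexive le) (le_anti : antisymmetric le).
Hypotheses (le_trans : transitive le) (le_total : total le).

Definition above T e : {set edge G} := [set f in T | (f != e) && le e f].

(** For [e] outside T this is external activity. For [e] in T it says that [e] is the minimum of a
    cycle inside T, so T is acyclic when none of its edges is active. *)
Definition active T e :=
  connect (adjacent_in (above T e)) (endpoints e).1 (endpoints e).2.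

Lemma sub_connect_adjacent S T : S \subset T ->
  forall u v, connect (adjacent_in S) u v -> connect (adjacent_in T) u v.
Proof.
move=> sST; apply: connect_sub => u v /existsP[f /andP[fS juv]].
by apply: connect1; apply/existsP; exists f; rewrite (subsetP sST).
Qed.

Lemma activeP T e : reflect
  (exists C, [/\ graph_cycle C, e \in C, forall f, f \in C -> le e f & C :\ e \subset T])
  (active T e).
Proof.
apply: (iffP idP) => [act|[C [cC eC leC CT]]].
  have eS : e \notin above T e by rewrite !inE eqxx andbF.
  have [C [cC eC CS]] := connect_graph_cycle eS act; exists C; split=> //.
    move=> f fC; have [->//|fe] := eqVneq f e.
    have : f \in above T e by rewrite (subsetP CS) // !inE fe.
    by rewrite !inE => /and3P[].
  by apply: subset_trans CS _; apply/subsetP => f; rewrite inE => /andP[].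
apply: sub_connect_adjacent (graph_cycle_connect cC eC).
apply/subsetP => f fC; rewrite inE (subsetP CT) //=.
by move: fC; rewrite in_setD1 => /andP[-> /leC ->].
Qed.

Lemma externally_activeE T e : externally_active le T e = (e \notin T) && active T e.
Proof.
congr (_ && _); apply/existsP/activeP => -[C]; last first.
  case=> c1 c2 c3 c4; exists C; rewrite c1 c2 c4 andbT.
  by apply/forallP => f; apply/implyP/c3.
by case/and4P=> c1 c2 /forallP c3 c4; exists C; split=> // f fC; have := c3 f; rewrite fC.
Qed.

Lemma exists_min C : C != set0 -> exists2 e, e \in C & forall f, f \in C -> le e f.
Proof.
move=> C0; have := sort_sorted le_total (enum C).
case E: (sort le (enum C)) => [|e s].
  case/set0Pn: C0 => x xC; have : x \in sort le (enum C) by rewrite mem_sort mem_enum.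
  by rewrite E.
move=> /(order_path_min le_trans)/allP lee; exists e.
  by rewrite -mem_enum -(mem_sort le) E mem_head.
by move=> f; rewrite -mem_enum -(mem_sort le) E inE => /orP[/eqP ->|/lee].
Qed.

Definition connects T := [forall u, forall v, connect (adjacent_in T) u v].

Lemma spanning_treeE T :
  spanning_tree T = connects T && [forall e in T, ~~ active T e].
Proof.
congr (_ && _); apply/negP/forallP => [nc e|na /existsP[C /andP[cC CT]]].
  apply/implyP => eT; apply/negP => /activeP[C [cC eC _ CT]]; apply: nc.
  apply/existsP; exists C; rewrite cC /=; apply/subsetP => f fC.
  by have [->//|fe] := eqVneq f e; rewrite (subsetP CT) // !inE fe.
have C0 : C != set0 by case/andP: cC; rewrite card_gt0.
have [e eC emin] := exists_min C0; have := na e; rewrite (subsetP CT) //=.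
move/negP; apply; apply/activeP; exists C; split=> //.
by apply: subset_trans CT; apply: subD1set.
Qed.

(** * Spanning trees followed through deletion and contraction *)

Implicit Type r : 'I_n.+1 -> option 'I_n.

(** Follows the branch of [ntrees] selected by T: edges of T are contracted and must not be loops by
    then, the others are deleted. *)
Fixpoint is_tree r s T : bool :=
  if s is e :: s' then
    if e \in T then
      (r (endpoints e).1 != r (endpoints e).2) && is_tree (glue r (endpoints e)) s' T
    else is_tree r s' T
  else one_label r.

Fixpoint inactivity r s T : nat :=
  if s is e :: s' then
    if e \in T then inactivity (glue r (endpoints e)) s' T
    else ((r (endpoints e).1 != r (endpoints e).2) + inactivity r s' T)%N
  else 0%N.

Lemma is_tree_eq r s T T' : {in s, T =i T'} ->
  is_tree r s T = is_tree r s T' /\ inactivity r s T = inactivity r s T'.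
Proof.
elim: s r => //= e s IH r eT.
have eTs : {in s, T =i T'} by move=> f fs; apply: eT; rewrite inE fs orbT.
rewrite (eT e (mem_head _ _)).
by have [-> ->] := IH r eTs; have [-> ->] := IH (glue r (endpoints e)) eTs.
Qed.

Lemma card_trees r s k : uniq s ->
  #|[set T : {set edge G} | [&& T \subset s, is_tree r s T & inactivity r s T == k]]|
    = ntrees r (map endpoints s) k.
Proof.
pose A r s k := [set T : {set edge G} | [&& T \subset s, is_tree r s T & inactivity r s T == k]].
rewrite -/(A r s k); elim: s r k => [|e s IH] r k /=.
  move=> _; case one: (one_label r); last first.
    rewrite andbF; apply/eqP; rewrite cards_eq0; apply/eqP/setP => T.
    by rewrite !inE /= one andbF.
  rewrite andbT; case: k => [|k] /=; last first.
    by apply/eqP; rewrite cards_eq0; apply/eqP/setP => T; rewrite !inE /= andbF andbF.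
  rewrite -(cards1 (set0 : {set edge G})); apply: eq_card => T; rewrite !inE /= one andbT.
  apply/subsetP/eqP => [h|-> x]; last by rewrite inE.
  by apply/setP => x; rewrite inE; apply/negP => /h.
case/andP=> es us; set r' := glue r (endpoints e).
have subs (T : {set edge G}) : (T \subset e :: s) && (e \notin T) = (T \subset s).
  apply/andP/idP => [[/subsetP h eT]|/subsetP h]; last first.
    split; last by apply: contra es => /h.
    by apply/subsetP => x /h xs; rewrite inE xs orbT.
  by apply/subsetP => x xT; have := h x xT; rewrite inE; case: eqP xT eT => // -> ->.
rewrite -(cardsID [set T : {set edge G} | e \notin T]) addnC.
have -> : A r (e :: s) k :\: [set T : {set edge G} | e \notin T] =
    [set e |: T | T in if r (endpoints e).1 == r (endpoints e).2 then set0
                       else A r' s k].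
  apply/setP => T; rewrite !inE negbK; apply/andP/imsetP.
    case=> eT; rewrite /= eT => /and3P[sT /andP[/negPf nl tT] iT]; exists (T :\ e).
      have [E1 E2] : is_tree r' s (T :\ e) = is_tree r' s T /\
          inactivity r' s (T :\ e) = inactivity r' s T.
        apply: is_tree_eq => f fs; rewrite in_setD1; case: eqP fs => // ->.
        by rewrite (negPf es).
      rewrite nl inE E1 E2 tT iT !andbT -subs in_setD1 eqxx andbT.
      by apply: subset_trans sT; apply: subD1set.
    by rewrite setD1K.
  case=> T'; case: eqP => [_|/eqP nl]; first by rewrite in_set0.
  rewrite in_set -subs => /and3P[/andP[sT' eT'] tT' iT'] ->; rewrite setU11; split=> //.
  have [E1 E2] : is_tree r' s (e |: T') = is_tree r' s T' /\
      inactivity r' s (e |: T') = inactivity r' s T'.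
    apply: is_tree_eq => f fs; rewrite in_setU1; case: eqP fs => // ->.
    by rewrite (negPf es).
  rewrite /= setU11 nl E1 E2 tT' iT' !andbT; apply/subsetP => f.
  by rewrite in_setU1 => /orP[/eqP ->|/(subsetP sT')]; rewrite ?mem_head.
rewrite card_in_imset; last first.
  have ne T : T \in (if r (endpoints e).1 == r (endpoints e).2 then set0
                     else A r' s k) -> e \notin T.
    by case: ifP => _; rewrite inE // -subs => /andP[/andP[]].
  by move=> T T' /ne eT /ne eT' eTT'; rewrite -(setU1K eT) -(setU1K eT') eTT'.
have -> : A r (e :: s) k :&: [set T : {set edge G} | e \notin T] =
    if r (endpoints e).1 == r (endpoints e).2 then A r s k
    else if k is k'.+1 then A r s k' else set0.
  apply/setP => T; rewrite !inE andbC andbA [(e \notin T) && _]andbC subs /=.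
  have [sT|nsT] := boolP (T \subset s); last first.
    by case: (r (endpoints e).1 == _); [|case: k => [|k']]; rewrite !inE ?(negPf nsT).
  have /negPf -> : e \notin T by move: sT; rewrite -subs => /andP[].
  case: (r (endpoints e).1 == _); first by rewrite in_set sT.
  by case: k => [|k']; rewrite ?in_set0 ?in_set ?sT ?andbF.
case: eqP => _; first by rewrite cards0 add0n IH.
by rewrite addnC IH //; case: k => [|k']; rewrite ?cards0 ?IH.
Qed.

Lemma glue_connect r F e :
    (forall x y, r x = r y <-> connect (adjacent_in F) x y) ->
  forall x y, glue r (endpoints e) x = glue r (endpoints e) y <->
    connect (adjacent_in (e |: F)) x y.
Proof.
move=> rF x y; have csym := adjacent_in_connect_sym (e |: F); split.
  move=> gxy; rewrite -(root_connect csym); apply/eqP.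
  move: x y gxy; apply: glue_univ => [x y|].
    move/rF => cxy; apply/eqP; rewrite (root_connect csym).
    by apply: sub_connect_adjacent cxy; apply: subsetU1.
  apply/eqP; rewrite (root_connect csym); apply/connect1/existsP; exists e.
  by rewrite setU11 joins_endpoints.
move=> /connectP[p pp ->] {y}; elim: p x pp => //= z p IH x /andP[/existsP[f /andP[fF jf]] pp].
rewrite -(IH _ pp); case/setU1P: fF => [fe|fF].
  by rewrite fe in jf; case/joinsE: jf => [] [-> ->]; rewrite glue_ends.
by apply/glue_coarser/rF/connect1/existsP; exists f; rewrite fF.
Qed.

Lemma is_tree_nlabels r s T : is_tree r s T -> (0 < nlabels r)%N ->
  nlabels r = (count (mem T) s).+1.
Proof.
elim: s r => [|e s IH] r /=.
  move=> one; rewrite /nlabels => /card_gt0P[a /imsetP[x _ _]].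
  rewrite -(cards1 (r x)); apply: eq_card => b; rewrite inE.
  apply/imsetP/eqP => [[y _ ->]|->]; last by exists x.
  by move/forallP/(_ y)/forallP/(_ x)/eqP: one.
case: ifP => eT; last exact: IH.
case/andP=> nl tT _; rewrite -(nlabels_glue nl) (IH _ tT) //.
by apply/card_gt0P; exists (glue r (endpoints e) (endpoints e).1); apply: imset_f.
Qed.

(** The invariant is that [r] records connectivity by the edges of T already scanned. As the scan is
    decreasing, these are the edges in [above T e] when [e] is reached, so [e] has become a loop
    exactly when it is active. *)
Lemma is_treeE T s r : uniq s -> sorted (fun x y => le y x) s ->
    (forall e f, e \in s -> f \notin s -> le e f) ->
    (forall x y, r x = r y <-> connect (adjacent_in [set f in T | f \notin s]) x y) ->
  is_tree r s T = all (fun e => (e \in T) ==> ~~ active T e) s && connects T /\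
  inactivity r s T = count (fun e => (e \notin T) && ~~ active T e) s.
Proof.
have ge_trans : transitive (fun x y => le y x) by move=> y x z yx zy; apply: le_trans zy yx.
elim: s r => [|e s IH] r us ss cs rk /=.
  split=> //; apply: eq_forallb => x; apply: eq_forallb => y.
  have -> : T = [set f in T | f \notin [::]] by apply/setP => f; rewrite inE andbT.
  by apply/eqP/idP => /rk.
case/andP: us => es us.
have ale f : f \in s -> le f e by move: ss => /(order_path_min ge_trans)/allP; apply.
have aE : [set f in T | f \notin e :: s] = above T e.
  apply/setP => f; rewrite !inE negb_or; case: (f \in T) => //=.
  have [//|fe] := eqVneq f e; apply/idP/idP => [fs|lef] /=.
    by apply: cs; rewrite ?mem_head // inE negb_or fe.
  by apply: contraNN fe => /ale lfe; apply/eqP/le_anti/andP.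
have actE : (r (endpoints e).1 != r (endpoints e).2) = ~~ active T e.
  by congr (~~ _); rewrite /active -aE; apply/eqP/idP => /rk.
have {}cs : forall e' f, e' \in s -> f \notin s -> le e' f.
  move=> e' f e's fs; have [->|fe] := eqVneq f e; first exact: ale.
  by apply: cs; rewrite inE ?e's ?orbT // negb_or fe.
have sE : [set f in T | f \notin s] =
    if e \in T then e |: [set f in T | f \notin e :: s] else [set f in T | f \notin e :: s].
  case: ifP => eT; apply/setP => f; rewrite !inE negb_or;
    by case: (eqVneq f e) => [->|_]; rewrite ?eT ?es ?orbF.
rewrite actE; case eT: (e \in T) sE => sE /=.
  have [|-> ->] := IH (glue r (endpoints e)) us (path_sorted ss) cs.
    by rewrite sE; apply: glue_connect.
  by rewrite andbA.
by have [|-> ->] := IH r us (path_sorted ss) cs; first by rewrite sE.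
Qed.

Lemma nb_trees_ntrees k :
  nb_trees le (#|edge G|%:Z - n%:Z - k%:Z)
    = ntrees (unlift ord0) (map endpoints (enum (edge G))) k.
Proof.
pose L := sort (fun x y => le y x) (enum (edge G)).
have pL : perm_eq L (enum (edge G)) by rewrite perm_sort.
have uL : uniq L by rewrite (perm_uniq pL) enum_uniq.
have mL e : e \in L by rewrite (perm_mem pL) mem_enum.
have nl : nlabels (unlift (@ord0 n)) = n.+1.
  rewrite /nlabels card_imset ?card_ord // => x y.
  case: unliftP => [i ->|->]; case: unliftP => [j ->|->] //.
  by case=> ->.
have nlpos : (0 < nlabels (unlift (@ord0 n)))%N by rewrite nl.
rewrite -(ntrees_perm _ nlpos (perm_map endpoints pL)) -card_trees //.
apply: eq_card => T; rewrite !inE.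
have [] := @is_treeE T L (unlift ord0) uL.
- by apply: sort_sorted => x y; apply: le_total.
- by move=> e f _; rewrite mL.
- move=> x y; have -> : [set f in T | f \notin L] = set0.
    by apply/setP => f; rewrite !inE mL andbF.
  split=> [|/connectP[[|z p] /= pp ->] //]; last first.
    by case/andP: pp => /existsP[f]; rewrite inE.
  case: unliftP => [i ->|->]; case: unliftP => [j ->|->] //.
  by case=> ->.
move=> tE iE; have -> : T \subset L by apply/subsetP => f _; apply: mL.
have -> : spanning_tree T = is_tree (unlift ord0) L T.
  rewrite spanning_treeE tE andbC; congr (_ && _).
  by apply/forallP/allP => [h e _|h e]; apply: h.
rewrite /=; case tT: (is_tree _ _ _) => //=.
have nT := is_tree_nlabels tT nlpos; rewrite nl in nT; case: nT => nT.
have cardL (P : pred (edge G)) : #|[set e | P e]| = count P L.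
  by rewrite (permP pL) -sum1_count big_enum_cond -sum1_card; apply: eq_bigl => e; rewrite inE.
(* Every edge is externally active, inactive outside T, or one of the n edges of T. *)
have : (external_activity le T + inactivity (unlift ord0) L T + count (mem T) L = #|edge G|)%N.
  rewrite iE /external_activity cardL (eq_count (externally_activeE T)).
  rewrite cardE -(perm_size pL); elim: (L) => //= e s IH; rewrite -[in RHS]IH.
  by case: (e \in T); case: (active T e); rewrite /= !(add0n, add1n) !(addSn, addnS).
rewrite -nT => <-; rewrite !PoszD addrK -addrA -subr_eq0 opprD addrA subrr sub0r.
by rewrite oppr_eq0 subr_eq0 eqz_nat.
Qed.

End Activity.
End Cycles.

(** * The ideals of a graph *)

Section GraphIdeals.
Variables (n : nat) (G : multigraph n).
Implicit Types (I : {set 'I_n}) (i : 'I_n).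

(** The uncontracted graph: each vertex is its own class, and vertex 0 is the root. *)
Let r0 : 'I_n.+1 -> option 'I_n := unlift ord0.
Let s0 := map (@endpoints n G) (enum (edge G)).

Lemma rooted_unlift : rooted r0.
Proof. by exists ord0; rewrite /r0 unlift_none. Qed.

Lemma live_unlift : live r0 = setT.
Proof.
apply/setP => i; rewrite in_setT; apply/liveP.
by exists (lift ord0 i); rewrite /r0 liftK.
Qed.

Lemma unlift_eq_some x i : (r0 x == Some i) = (x == vertex i).
Proof.
rewrite /r0 /vertex; case: unliftP => [j ->|->]; first by rewrite (inj_eq lift_inj).
by rewrite (negPf (neq_lift _ _)).
Qed.

Lemma label_in_unlift I x : label_in I (r0 x) = (x \in @vertex n @: I).
Proof.
rewrite /r0; case: unliftP => [j ->|->] /=.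
  by rewrite mem_imset //; apply: lift_inj.
apply/esym/imsetP => -[i _ /eqP]; apply/negP; exact: neq_lift.
Qed.

Lemma out_deg_cut_deg I i : i \in I -> out_deg G I i = cut_deg r0 s0 I i.
Proof.
move=> iI; rewrite /out_deg /cut_deg /s0 count_map -sum1_count big_enum_cond /=.
rewrite [RHS]big_mkcond /=.
rewrite (eq_bigr (fun j => \sum_(e : edge G) nat_of_bool (joins e (vertex i) j))%N); last first.
  move=> j _; rewrite /nb_edges -sum1_card big_mkcond /=; apply: eq_bigr => e _.
  by rewrite inE; case: joins.
rewrite exchange_big /=; apply: eq_bigr => e _; rewrite !unlift_eq_some !label_in_unlift.
have viI : vertex i \in @vertex n @: I by apply: imset_f.
case: ifPn => [cond|/negP ncond]; last first.
  rewrite big1 // => j jI; apply/eqP; rewrite eqb0; apply/negP => /joinsE h; apply: ncond.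
  by case: h => [] [<- <-]; rewrite eqxx jI ?orbT.
(* An edge leaving [I] at [i] has a unique other end, so it contributes once to the sum over j. *)
have [j jI jj] : exists2 j, j \notin @vertex n @: I & joins e (vertex i) j.
  case/orP: cond => /andP[/eqP <- nI].
    by exists (endpoints e).2 => //; apply: joins_endpoints.
  by exists (endpoints e).1 => //; rewrite joinsC; apply: joins_endpoints.
rewrite (bigD1 j) //= jj big1 // => j' /andP[j'I j'j].
apply/eqP; rewrite eqb0; apply/negP => /eqP jj'; move: jj; rewrite /joins jj' => /eqP/set2_inj.
by case=> [] [E1 E2]; [rewrite E2 eqxx in j'j | rewrite E1 in viI; rewrite viI in jI].
Qed.

Lemma out_total_count I : out_total G I = count (crosses r0 I) s0.
Proof. by rewrite -sum_cut_deg; apply: eq_bigr => i; apply: out_deg_cut_deg. Qed.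

(** * Bases of the graded components *)

Variable K : fieldType.

Definition cut_monom I : 'X_{1..n} := [multinom ((i \in I) * out_deg G I i)%N | i < n].

Lemma mono_genE I : mono_gen K G I = 'X_[cut_monom I].
Proof.
rewrite /mono_gen mpolyXE_id big_mkcond; apply: eq_bigr => i _.
by rewrite mnmE; case: (i \in I); rewrite ?mul1n ?mul0n ?expr0.
Qed.

Lemma parkingPn m :
  reflect (exists2 I, I != set0 & (cut_monom I <= m)%MM) (~~ parking r0 s0 m).
Proof.
apply: (iffP idP) => [np|[I I0 /mnm_lepP le]].
  have /existsP[I /andP[I0 Im]] : [exists I : {set 'I_n}, (I != set0) && (cut_monom I <= m)%MM].
    apply: contraR np; rewrite negb_exists => /forallP h; apply/parkingP.
    rewrite live_unlift; split=> [i|I I0 _]; first by rewrite inE.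
    have := h I; rewrite I0 /= => /mnm_lepP nle.
    apply/exists_inP; apply: contra_notT nle => /exists_inPn h' i.
    rewrite mnmE; case: (boolP (i \in I)) => iI; rewrite ?mul0n // mul1n.
    by rewrite out_deg_cut_deg // leqNgt; apply: h'.
  by exists I.
apply/negP => /parkingP[_ /(_ I I0)]; rewrite live_unlift => /(_ (subsetT _))[i iI].
by rewrite ltnNge -out_deg_cut_deg //; have := le i; rewrite mnmE iI mul1n => ->.
Qed.

Lemma ideal_genD (R : comNzRingType) (X : finType) (P : pred X) (g : X -> R) p q :
  ideal_gen P g p -> ideal_gen P g q -> ideal_gen P g (p + q).
Proof.
move=> [h1 ->] [h2 ->]; exists (fun x => h1 x + h2 x); rewrite -big_split /=.
by apply: eq_bigr => x _; rewrite mulrDl.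
Qed.

Lemma ideal_gen0 (R : comNzRingType) (X : finType) (P : pred X) (g : X -> R) :
  ideal_gen P g 0.
Proof. by exists (fun=> 0); rewrite big1 // => x _; rewrite mul0r. Qed.

Lemma ideal_gen_mul (R : comNzRingType) (X : finType) (P : pred X) (g : X -> R) x h :
  P x -> ideal_gen P g (h * g x).
Proof.
move=> Px; exists (fun y => if y == x then h else 0).
rewrite (bigD1 x) //= eqxx big1 ?addr0 // => y /andP[_ /negPf ->].
by rewrite mul0r.
Qed.

Lemma ideal_I_nonparking m c : ~~ parking r0 s0 m -> ideal_I K G (c *: 'X_[m]).
Proof.
case/parkingPn=> I I0 Im.
have -> : c *: 'X_[m] = (c *: 'X_[(m - cut_monom I)%MM]) * mono_gen K G I.
  by rewrite mono_genE -scalerAl -mpolyXD submK.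
exact: ideal_gen_mul.
Qed.

Lemma ideal_I_coef p m : ideal_I K G p -> parking r0 s0 m -> p@_m = 0.
Proof.
case=> h -> pm; rewrite raddf_sum /= big1 // => I I0; apply/eqP; rewrite mcoeff_eq0.
rewrite mono_genE (perm_mem (msuppMX _ _)); apply/mapP => -[m' _ mE].
move/negP: pm; apply; apply/negP/parkingPn; exists I => //; apply/mnm_lepP => i.
by rewrite mE mnmDE leq_addr.
Qed.

(** The parking monomials of degree k form a basis: other monomials lie in the ideal, and members of
    the ideal have no parking monomial. *)
Lemma graded_dim_ideal_I k : graded_dim (ideal_I K G) k (ntrees r0 s0 k).
Proof.
have [L [uL mL <-]] := parking_enum s0 rooted_unlift k.
pose b (i : 'I_(size L)) : {mpoly K[n]} := 'X_[nth 0%MM L i].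
have bL (i : 'I_(size L)) : nth 0%MM L i \in L by apply: mem_nth.
have coefb (c : 'I_(size L) -> K) (i : 'I_(size L)) : (\sum_j c j *: b j)@_(nth 0%MM L i) = c i.
  rewrite raddf_sum /= (bigD1 i) //= mcoeffZ mcoeffX eqxx mulr1 big1 ?addr0 // => j ji.
  by rewrite mcoeffZ mcoeffX nth_uniq // val_eqE (negPf ji) mulr0.
exists b; split.
- by move=> i; have := bL i; rewrite mL dhomogX => /andP[].
- move=> p hp; exists (fun j => p@_(nth 0%MM L j)).
  set q := p - _; rewrite [q]mpolyE.
  have qL m : m \in L -> q@_m = 0.
    move=> mL'; have iL : (index m L < size L)%N by rewrite index_mem.
    have -> : m = nth 0%MM L (Ordinal iL) by rewrite nth_index.
    by rewrite mcoeffB coefb subrr.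
  have hq : q \is k.-homog.
    apply: rpredB => //; apply: rpred_sum => i _; apply: rpredZ.
    by have := bL i; rewrite mL dhomogX => /andP[].
  rewrite big_seq; apply: big_rec => [|m x mq Ix]; first exact: ideal_gen0.
  apply: ideal_genD => //; apply: ideal_I_nonparking; apply/negP => pm.
  move: (mq); rewrite mcoeff_msupp qL ?eqxx // mL pm /=.
  by apply/eqP; apply: (dhomog_mf hq).
- move=> c Ic i; rewrite -(coefb c); apply: ideal_I_coef Ic _.
  by have := bL i; rewrite mL => /andP[].
Qed.

Lemma ideal_J_apolar p : ideal_J K G p -> apolar r0 s0 p.
Proof.
case=> h ->; apply: big_rec => [|I q I0 oq]; first exact: apolar0.
apply: apolarD => //; rewrite /power_gen out_total_count; apply: apolar_power.
by rewrite live_unlift setIT.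
Qed.

Lemma power_span_ideal_J k p : power_span r0 s0 k p -> ideal_J K G p.
Proof.
elim=> [|I h d q I0 _ _ _ _ _ IH]; first exact: ideal_gen0.
apply: ideal_genD => //; rewrite -out_total_count.
exact: (@ideal_gen_mul _ _ (fun I : {set 'I_n} => I != set0) (power_gen K G)).
Qed.

(** The ideal lies between [power_span] and [apolar], so the basis of [power_basis] spans modulo it
    by the first inclusion and is independent by the second. *)
Lemma graded_dim_ideal_J k : [pchar K] =i pred0 ->
  graded_dim (ideal_J K G) k (ntrees r0 s0 k).
Proof.
move=> char0.
have [X [b [<- bh spanb freeb]]] := power_basis s0 char0 rooted_unlift k.
have sumE (c : X -> K) :
    \sum_(j < #|X|) c (enum_val j) *: b (enum_val j) = \sum_x c x *: b x.
  by rewrite [RHS](reindex _ (onW_bij _ (enum_val_bij X))).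
exists (fun j => b (enum_val j)); split.
- by move=> j; have [] := bh (enum_val j).
- move=> p hp; have [|c cP] := spanb p hp.
    by move=> i; rewrite live_unlift inE.
  by exists (fun j => c (enum_val j)); rewrite sumE; apply: power_span_ideal_J cP.
- move=> c Jc j; rewrite -[j]enum_valK; move: (enum_val j) => x.
  apply: (freeb (fun x => c (enum_rank x))); rewrite -sumE; apply: ideal_J_apolar.
  by under eq_bigr => j' _ do rewrite enum_valK.
Qed.

End GraphIdeals.

Theorem theorem3p3 (n : nat) (G : multigraph n) (K : fieldType)
    (le : rel (edge G))
    (le_refl : reflexive le) (le_anti : antisymmetric le)
    (le_trans : transitive le) (le_total : total le) (k : nat) :
  let N := nb_trees le ((#|edge G|)%:Z - n%:Z - k%:Z) in
  graded_dim (ideal_I K G) k N /\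
  ([pchar K] =i pred0 -> graded_dim (ideal_J K G) k N).
Proof.
rewrite /= nb_trees_ntrees //; split; first exact: graded_dim_ideal_I.
exact: graded_dim_ideal_J.
Qed.
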